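(* If $\mathcal{B}\neq\emptyset$, then $D(S)$ is left Noetherian. In particular, $D(S)$ is left Noetherian if $S$ satisfies Serre's condition $(S_2)$, i.e. if $S=\bigcap_{\sigma\in\mathcal{F}}(S+\mathbb{Z}(A\cap\sigma))$.
   Context: $K$ is an algebraically closed field of characteristic zero. $A\subset\mathbb{Z}^d$ is a finite set with $\mathbb{Z}A=\mathbb{Z}^d$ and with strongly convex cone $\mathbb{R}_{\geq 0}A$; $\mathbb{N}A$ is the monoid generated by $A$. $\mathcal{F}$ is the set of facets of $\mathbb{R}_{\geq 0}A$. For $\sigma\in\mathcal{F}$, $F_\sigma$ is the unique linear form on $\mathbb{R}^d$ with $F_\sigma(\mathbb{R}_{\geq 0}A)\geq 0$, $F_\sigma(\sigma)=0$, $F_\sigma(\mathbb{Z}^d)=\mathbb{Z}$. For a face $\tau$, $\mathbb{Z}(A\cap\tau)$ is the group generated by $A\cap\tau$, and $K\tau\subseteq K^d$ is the $K$-linear span of $A\cap\tau$. $\tau\succeq\tau'$ means that $\tau'$ is a face of $\tau$. $T\subseteq\mathbb{Z}^d$ is an $\mathbb{N}A$-set if $T+\mathbb{N}A\subseteq T$; it is finitely generated if $T=G+\mathbb{N}A$ with $G$ finite; it is scored if $T=\bigcap_{\sigma\in\mathcal{F}}\{\mathbf{a}\in\mathbb{Z}^d:F_\sigma(\mathbf{a})\in F_\sigma(T)\}$. Standing setting: $S_c$ is a finitely generated scored $\mathbb{N}A$-set, $\mathbf{b}_1,\ldots,\mathbf{b}_m\in S_c$, $\tau_1,\ldots,\tau_m$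 are faces of $\mathbb{R}_{\geq 0}A$, $S=S_c\setminus\bigcup_{i=1}^m(\mathbf{b}_i+\mathbb{Z}(A\cap\tau_i))$, this expression is irredundant (no $\mathbf{b}_i+\mathbb{Z}(A\cap\tau_i)$ can be omitted), $F_\sigma(S)=F_\sigma(S_c)$ for all $\sigma\in\mathcal{F}$, and $S$ is an $\mathbb{N}A$-set. $\tilde{\mathcal{F}}=\mathcal{F}\cup\{\tau_i: i=1,\ldots,m\}$. $\mathcal{B}$ is the set of families $(\mathbf{b}_\tau)_{\tau\in\tilde{\mathcal{F}}}$ with $\mathbf{b}_\tau\in (K\tau\cap\mathbb{Z}^d)/\mathbb{Z}(A\cap\tau)$ for all $\tau\in\tilde{\mathcal{F}}$ such that for all $i$ and all $\tau\in\tilde{\mathcal{F}}$ with $\tau\succeq\tau_i$ there exists $j$ with $\tau_j=\tau$ and $\mathbf{b}_i+\mathbf{b}_{\tau_i}=\mathbf{b}_j+\mathbf{b}_{\tau_j}$ mod $\mathbb{Z}(A\cap\tau)$. $D(\mathbb{Z}^d)=K[t_1^{\pm1},\ldots,t_d^{\pm1}]\langle\partial_1,\ldots,\partial_d\rangle$ acts on $K[t_1^{\pm1},\ldots,t_d^{\pm1}]$. For $T\subseteq\mathbb{Z}^d$, $K[T]=\bigoplus_{\mathbf{a}\in T}Kt^{\mathbf{a}}$ and $D(T)=\{P\in D(\mathbb{Z}^d):P(K[T])\subseteq K[T]\}$. *)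

(* Defs.v *)
From HB Require Import structures.
From mathcomp Require Import all_boot all_order all_algebra finmap.
From mathcomp Require Import boolp classical_sets reals.
From mathcomp.multinomials Require Import monalg.

Set Implicit Arguments.
Unset Strict Implicit.
Unset Printing Implicit Defensive.

Import Order.TTheory GRing.Theory Num.Theory.

Local Open Scope classical_set_scope.
Local Open Scope ring_scope.

Definition left_ideal (R : pzRingType) (I : set R) : Prop :=
  [/\ I 0, forall x y, I x -> I y -> I (x + y)
    & forall a x, I x -> I (a * x)].

Definition left_span (R : pzRingType) (s : seq R) : set R :=
  [set x | exists c : 'I_(size s) -> R, x = \sum_i c i * s`_i].

Definition left_noetherian (R : pzRingType) : Prop :=
  forall I : set R, left_ideal I -> exists s : seq R, I = left_span s.

(* The library has no ring structure on the linear endomorphisms of a module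
   that need not be finite-dimensional: we equip them with pointwise addition
   and with composition. *)
Section Endomorphisms.
Variables (K : comNzRingType) (V : lmodType K).

Definition endo : Type := {linear V -> V}.
Identity Coercion linear_of_endo : endo >-> GRing.Linear.type.

HB.instance Definition _ := gen_eqMixin endo.
HB.instance Definition _ := gen_choiceMixin endo.

Definition mk_endo (f : V -> V) (lin_f : linear f) : endo :=
  HB.pack_for {linear V -> V} f (GRing.isLinear.Build K V V *:%R f lin_f).

Lemma endoP (f g : endo) : f =1 g -> f = g.
Proof.
move=> /funext; case: f => f [[cf] [cf']]; case: g => g [[cg] [cg']] /= fg.
subst g; congr GRing.Linear.Pack; congr GRing.Linear.Class;
  by congr (_ _); apply: Prop_irrelevance.
Qed.

Lemma endo_linear (f : endo) : linear f. Proof. exact: linearP. Qed.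

Fact endo_zero_linear : linear (fun _ : V => 0 : V).
Proof. by move=> a x y; rewrite scaler0 addr0. Qed.
Definition endo_zero := mk_endo endo_zero_linear.

Fact endo_opp_linear (f : endo) : linear (fun x => - f x).
Proof. by move=> a x y; rewrite endo_linear opprD scalerN. Qed.
Definition endo_opp f := mk_endo (endo_opp_linear f).

Fact endo_add_linear (f g : endo) : linear (fun x => f x + g x).
Proof. by move=> a x y; rewrite !endo_linear scalerDr addrACA. Qed.
Definition endo_add f g := mk_endo (endo_add_linear f g).

Fact endo_id_linear : linear (fun x : V => x).
Proof. by []. Qed.
Definition endo_id := mk_endo endo_id_linear.

Fact endo_comp_linear (f g : endo) : linear (fun x => f (g x)).
Proof. by move=> a x y; rewrite !endo_linear. Qed.
Definition endo_comp f g := mk_endo (endo_comp_linear f g).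

Fact endo_scalar_linear (c : K) : linear (fun x : V => c *: x).
Proof. by move=> a x y; rewrite scalerDr !scalerA mulrC. Qed.
Definition endo_scalar c := mk_endo (endo_scalar_linear c).

Fact endo_addA : associative endo_add.
Proof. by move=> f g h; apply: endoP => x /=; rewrite addrA. Qed.
Fact endo_addC : commutative endo_add.
Proof. by move=> f g; apply: endoP => x /=; rewrite addrC. Qed.
Fact endo_add0 : left_id endo_zero endo_add.
Proof. by move=> f; apply: endoP => x /=; rewrite add0r. Qed.
Fact endo_addN : left_inverse endo_zero endo_opp endo_add.
Proof. by move=> f; apply: endoP => x /=; rewrite addNr. Qed.

HB.instance Definition _ := GRing.isZmodule.Build endo
  endo_addA endo_addC endo_add0 endo_addN.

Fact endo_compA : associative endo_comp.
Proof. by move=> f g h; apply: endoP. Qed.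
Fact endo_comp1 : left_id endo_id endo_comp.
Proof. by move=> f; apply: endoP. Qed.
Fact endo_1comp : right_id endo_id endo_comp.
Proof. by move=> f; apply: endoP. Qed.
Fact endo_compDl : left_distributive endo_comp +%R.
Proof. by move=> f g h; apply: endoP. Qed.
Fact endo_compDr : right_distributive endo_comp +%R.
Proof. by move=> f g h; apply: endoP => x /=; rewrite raddfD. Qed.

HB.instance Definition _ := GRing.Zmodule_isPzRing.Build endo
  endo_compA endo_comp1 endo_1comp endo_compDl endo_compDr.

End Endomorphisms.

(* A Laurent polynomial is the finitely supported family of its coefficients.
   {malg K[M]} carries a ring structure only for monoids M without nontrivial
   units, so we use its K-module structure and define directly the operators
   f |-> t_i^{+-1} f and f |-> df/dt_i. *)
Definition laurent (K : comNzRingType) (d : nat) : Type := {malg K['rV[int]_d]}.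

Section DifferentialOperators.
Variables (K : comNzRingType) (d : nat).

HB.instance Definition _ := GRing.Lmodule.on (laurent K d).

(* the K-linear operator t^a |-> c(a) t^(a + e) *)
Definition monop_fun (c : 'rV[int]_d -> K) (e : 'rV[int]_d)
    (f : laurent K d) : laurent K d :=
  \sum_(a <- msupp f) mkmalgU (a + e) (c a * f@_a).

Lemma mcoeff_monop c e (f : laurent K d) b :
  (monop_fun c e f)@_b = c (b - e) * f@_(b - e).
Proof.
rewrite /monop_fun raddf_sum /=.
have [be_f|be_f] := boolP (b - e \in msupp f); last first.
  rewrite (mcoeff_outdom be_f) mulr0 big_seq big1 // => a af.
  rewrite mcoeffU; case: eqP => // ab.
  by move: be_f; rewrite -ab addrK af.
rewrite (big_fsetD1 (b - e)) //= mcoeffU subrK eqxx mulr1n.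
rewrite big_seq big1 ?addr0 // => a; rewrite in_fsetD1 => /andP[a_be _].
rewrite mcoeffU; case: eqP => // ab.
by move: a_be; rewrite -ab addrK eqxx.
Qed.

Fact monop_linear c e : linear (monop_fun c e).
Proof.
move=> k f g; apply/malgP => b.
by rewrite !(mcoeffD, mcoeffZ, mcoeff_monop) mulrDr mulrCA.
Qed.

Definition monop c e : endo (laurent K d) := mk_endo (monop_linear c e).

Definition unit_row (i : 'I_d) : 'rV[int]_d := delta_mx 0 i.

Definition laurent_mulX (i : 'I_d) := monop (fun=> 1) (unit_row i).

Definition laurent_mulXinv (i : 'I_d) := monop (fun=> 1) (- unit_row i).

Definition laurent_deriv (i : 'I_d) :=
  monop (fun a => (a 0 i)%:~R) (- unit_row i).

(* In characteristic zero, K[t_1^{+-1}, ..., t_d^{+-1}]<d_1, ..., d_d> acts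
   faithfully on Laurent polynomials; we identify it with its image. *)
Definition DZ_generators : set (endo (laurent K d)) :=
  range (@endo_scalar K (laurent K d)) `|` range laurent_mulX
  `|` range laurent_mulXinv `|` range laurent_deriv.

Definition DZ : set (endo (laurent K d)) :=
  smallest (fun E : set (endo (laurent K d)) =>
              subring_closed [pred P | P \in E]) DZ_generators.

Definition monomial_span (T : set 'rV[int]_d) : set (laurent K d) :=
  [set f | forall a, a \in msupp f -> T a].

Definition Dpred (T : set 'rV[int]_d) : pred (endo (laurent K d)) :=
  [pred P | `[< DZ P /\ P @` monomial_span T `<=` monomial_span T >]].

Fact Dpred_subring_closed T : subring_closed (Dpred T).
Proof.
split.
- apply/asboolP; split; first by move=> E [[E1 _ _] _]; exact: set_mem E1.
  by move=> _ [f Tf <-].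
- move=> P Q /asboolP[DP TP] /asboolP[DQ TQ]; apply/asboolP; split.
    move=> E HE; have [[_ EB _] _] := HE.
    by apply: set_mem; apply: EB; apply: mem_set; [exact: DP|exact: DQ].
  move=> _ [f Tf <-] a; rewrite -mcoeff_neq0 mcoeffB => nz.
  have [Pf0|Pf0] := eqVneq ((P f)@_a) 0.
    apply: (TQ (Q f)); first by exists f.
    by rewrite -mcoeff_neq0; move: nz; rewrite Pf0 sub0r oppr_eq0.
  by apply: (TP (P f)); [exists f|rewrite -mcoeff_neq0].
- move=> P Q /asboolP[DP TP] /asboolP[DQ TQ]; apply/asboolP; split.
    move=> E HE; have [[_ _ EM] _] := HE.
    by apply: set_mem; apply: EM; apply: mem_set; [exact: DP|exact: DQ].
  by move=> _ [f Tf <-]; apply: TP; exists (Q f) => //; apply: TQ; exists f.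
Qed.

HB.instance Definition _ T :=
  GRing.isSubringClosed.Build (endo (laurent K d)) (Dpred T)
    (Dpred_subring_closed T).

Record Dring (T : set 'rV[int]_d) : predArgType :=
  DOp { Dval :> endo (laurent K d); Dval_in : Dval \in Dpred T }.

HB.instance Definition _ T := [isSub for @Dval T].
HB.instance Definition _ T := [Choice of Dring T by <:].
HB.instance Definition _ T :=
  GRing.SubChoice_isSubPzRing.Build (endo (laurent K d)) (Dpred T) (Dring T)
    (Dpred_subring_closed T).

End DifferentialOperators.

Definition setadd (V : zmodType) (X Y : set V) : set V :=
  [set x + y | x in X & y in Y].

Section Cones.
Variable d : nat.
Implicit Types (A : {fset 'rV[int]_d}) (T : set 'rV[int]_d).

Definition emb (F : pzRingType) (a : 'rV[int]_d) : 'rV[F]_d := map_mx intr a.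

Definition NN A : set 'rV[int]_d :=
  [set x | exists c : 'rV[int]_d -> nat, x = \sum_(a <- A) a *+ c a].

Definition ZZ A : set 'rV[int]_d :=
  [set x | exists c : 'rV[int]_d -> int, x = \sum_(a <- A) a *~ c a].

Definition fspan (F : fieldType) A : {vspace 'rV[F]_d} :=
  <<[seq emb F a | a <- A]>>%VS.

Definition is_NNset A T : Prop := setadd T (NN A) `<=` T.

Definition fin_gen A T : Prop :=
  exists G : {fset 'rV[int]_d}, T = setadd [set` G] (NN A).

Variable R : realType.
Implicit Types (C tau sigma : set 'rV[R]_d) (F : 'cV[R]_d).

Definition cone A : set 'rV[R]_d :=
  [set x | exists2 c : 'rV[int]_d -> R,
     (forall a, 0 <= c a) & x = \sum_(a <- A) c a *: emb R a].

Definition strongly_convex C : Prop := forall x, C x -> C (- x) -> x = 0.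

(* the linear form on R^d with coefficient vector F *)
Definition form F (x : 'rV[R]_d) : R := (x *m F) 0 0.

Definition is_face C tau : Prop :=
  exists2 F, (forall x, C x -> 0 <= form F x)
    & tau = C `&` [set x | form F x = 0].

Definition face_gens A tau : {fset 'rV[int]_d} :=
  [fset a in A | emb R a \in tau]%fset.

(* When A generates Z^d the cone has dimension d, and a face sigma spans the
   same subspace of R^d as the points of A lying on it. So facets are the faces
   of dimension d - 1; there are none when d = 0. *)
Definition facets A : set (set 'rV[R]_d) :=
  [set sigma | is_face (cone A) sigma /\
               (\dim (fspan R (face_gens A sigma))).+1 = d].

Definition is_facet_form A sigma F : Prop :=
  [/\ forall x, cone A x -> 0 <= form F x,
      forall x, sigma x -> form F x = 0
    & [set form F (emb R a) | a in [set: 'rV[int]_d]] = range intr].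

Definition facet_form A sigma : 'cV[R]_d := xget 0 (is_facet_form A sigma).

Definition Fsigma A sigma (a : 'rV[int]_d) : R :=
  form (facet_form A sigma) (emb R a).

Definition scored A T : Prop :=
  T = \bigcap_(sigma in facets A)
        [set a | (Fsigma A sigma @` T) (Fsigma A sigma a)].

Definition serre_S2 A T : Prop :=
  T = \bigcap_(sigma in facets A) setadd T (ZZ (face_gens A sigma)).

Variables (m : nat) (b : 'I_m -> 'rV[int]_d) (tau : 'I_m -> set 'rV[R]_d).

Definition hole A (i : 'I_m) : set 'rV[int]_d :=
  setadd [set b i] (ZZ (face_gens A (tau i))).

Definition Ftilde A : set (set 'rV[R]_d) := facets A `|` range tau.

(* A family is a function on all sets, of which only the values on Ftilde
   matter. The class b_tau in (K tau `&` Z^d)/Z(A `&` tau) is a coset, i.e. a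
   subset of Z^d; congruence of two classes mod Z(A `&` t) is equality of the
   cosets of Z(A `&` t) obtained by adding Z(A `&` t) to each. *)
Definition calB (K : fieldType) A :
    set (set 'rV[R]_d -> set 'rV[int]_d) :=
  [set beta |
    (forall t, Ftilde A t ->
       exists2 c : 'rV[int]_d, emb K c \in fspan K (face_gens A t)
         & beta t = setadd [set c] (ZZ (face_gens A t))) /\
    (forall i t, Ftilde A t -> is_face t (tau i) ->
       exists2 j, tau j = t
         & setadd (setadd [set b i] (beta (tau i))) (ZZ (face_gens A t)) =
           setadd (setadd [set b j] (beta (tau j))) (ZZ (face_gens A t)))].

End Cones.

(* Main.v *)
Require Import Defs.
From HB Require Import structures.
From mathcomp Require Import all_boot all_order all_algebra finmap.
From mathcomp Require Import boolp classical_sets reals.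
From mathcomp Require Import functions cardinality zify ring.
From mathcomp.multinomials Require Import monalg.

(** An element of D(Z^d) is a finite sum of operators t^a f_a(s), where
    s_i = t_i d/dt_i, f_a is a polynomial, and t^a f(s) sends t^x to
    f(x) t^(x+a). It lies in D(S) if and only if every f_a vanishes at the
    points x of S with x + a outside S, the exits of a. The proof is a
    leading-term argument for this grading by Z^d.

    For a facet sigma with primitive normal u, so that F_sigma = lform u, let
    M_u be F_sigma(Sc) without the hole levels F_sigma(b_j), tau_j = sigma.
    Let r_a be the product of the F_sigma - n over all facets and all n in M_u
    with n + F_sigma(a) outside M_u. For each such factor the exits of a on
    the hyperplane F_sigma = n are Zariski dense in it, so r_a divides f_a
    (divisor_dvd). The converse fails, but only on finitely many hyperplanes,
    the same for all a, as soon as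
      F_sigma(b_i) is a hole level of sigma for every hole i and every facet
      sigma containing tau_i.
    Indeed, let a be a multiple of a suitable integer, let x be an exit of a
    with x + a in hole i, and let r_a(x) be nonzero. For every facet sigma
    containing tau_i, F_sigma(x) is a hole level too, like F_sigma(x + a). If
    F_sigma(a) = 0 for all of them, then a lies in the span of tau_i, hence in
    Z(A cap tau_i), and x lies in hole i as well, which is absurd
    (S_exit_level). A family in B gives the
    displayed condition because F_sigma kills the corrections b_tau
    (calB_hole_level). Under (S_2) irredundancy forces every tau_i to be a
    facet, and the condition is immediate (serre_hole_level).

    The lattice is well-ordered by comparing lexicographically the absolute
    values of the F_sigma and of the coordinates, ties being broken by signs.
    If a and b point in the same direction for all these forms, then adding b
    sends indices below a to indices below a + b (keylt_add), and if moreover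
    the steps are long enough, then r_b(s + a) r_a = r_(a+b) (divisor_step).
    Hence the leading coefficients of the elements of a left ideal of D(S),
    divided by r_a, form a family of ideals X_a of K[s] which is closed under
    transitions from a to c. In an increasing chain of left ideals these
    families detect the growth (leading_inj).

    So an ascending chain condition for families of ideals of K[s] is needed
    (acc_systems). Noetherian induction reduces it to the following: for every
    prime P there is an almost full relation on the indices and, for every a,
    some q outside P which is a transition from a to every c above a. For D(S)
    one takes for q the product of the F_sigma(s + a) - n, n a hole level, that
    are not in P. If such a factor is in P, then F_sigma(a) is bounded in terms
    of P, and c is only related to a if F_sigma(c) = F_sigma(a). No operator of
    degree c - a then moves a point across the levels of sigma, so that
    hyperplane needs no factor (transition_prime). *)

Set Implicit Arguments.
Unset Strict Implicit.
Unset Printing Implicit Defensive.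

Import Order.TTheory GRing.Theory Num.Theory.

Local Open Scope classical_set_scope.
Local Open Scope ring_scope.

(** * Ascending chains of families of ideals *)

Definition acc_ideals (T : pzRingType) : Prop :=
  forall J : nat -> set T, (forall n, left_ideal (J n)) ->
  (forall n, J n `<=` J n.+1) ->
  exists n0, forall n, (n0 <= n)%N -> J n `<=` J n0.

Lemma chain_le (U : Type) (J : nat -> set U) :
  (forall n, J n `<=` J n.+1) -> forall n k, (n <= k)%N -> J n `<=` J k.
Proof.
move=> J_S n k; elim: k => [|k IHk]; first by rewrite leqn0 => /eqP->.
rewrite leq_eqVlt => /predU1P[->//|/IHk nk x /nk]; exact: J_S.
Qed.

Lemma acc_maximal (T : pzRingType) (B : set (set T)) :
  acc_ideals T -> (forall J, B J -> left_ideal J) -> B !=set0 ->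
  exists2 M, B M & forall J, B J -> M `<=` J -> J `<=` M.
Proof.
move=> accT B_ideal [J0 BJ0]; apply: contrapT => noM.
have next (J : {J | B J}) : exists J' : {J | B J},
    sval J `<=` sval J' /\ ~ (sval J' `<=` sval J).
  apply: contrapT => noJ'; apply: noM; exists (sval J); first exact: (svalP J).
  move=> J' BJ' JJ'; apply: contrapT => nJ'J.
  by apply: noJ'; exists (exist _ J' BJ').
have [s sP] := choice next.
pose J n := sval (iter n s (exist _ J0 BJ0)).
have [n0 n0P] : exists n0, forall n, (n0 <= n)%N -> J n `<=` J n0.
  apply: accT => n; first exact: B_ideal (svalP _).
  by case: (sP (iter n s (exist _ J0 BJ0))).
by case: (sP (iter n0 s (exist _ J0 BJ0))) => _; apply; exact: (n0P n0.+1).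
Qed.

Lemma left_span_ideal (R : pzRingType) (s : seq R) : left_ideal (left_span s).
Proof.
split.
- by exists (fun=> 0); rewrite big1 // => i _; rewrite mul0r.
- move=> _ _ [c ->] [c' ->]; exists (fun i => c i + c' i).
  by rewrite -big_split; apply: eq_bigr => i _; rewrite mulrDl.
- move=> a _ [c ->]; exists (fun i => a * c i).
  by rewrite mulr_sumr; apply: eq_bigr => i _; rewrite mulrA.
Qed.

Lemma left_span_gen (R : pzRingType) (s : seq R) x : x \in s -> left_span s x.
Proof.
move=> xs; have lt : (index x s < size s)%N by rewrite index_mem.
exists (fun i => (i == Ordinal lt)%:R); rewrite (bigD1 (Ordinal lt)) //= eqxx.
rewrite mul1r nth_index // big1 ?addr0 // => i /negPf->.
by rewrite mul0r.
Qed.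

Lemma left_span_sub (R : pzRingType) (s : seq R) (I : set R) :
  left_ideal I -> (forall x, x \in s -> I x) -> left_span s `<=` I.
Proof.
move=> [I0 ID IM] sI _ [c ->]; elim/big_ind: _ => // i _.
by apply/IM/sI; exact: mem_nth.
Qed.

Lemma acc_left_noetherian (R : pzRingType) :
  acc_ideals R -> left_noetherian R.
Proof.
move=> accR I I_ideal; apply: contrapT => nogen.
have next (s : {s : seq R | forall x, x \in s -> I x}) :
    exists x, I x /\ ~ left_span (sval s) x.
  apply: contrapT => nox; apply: nogen; exists (sval s).
  apply/seteqP; split; last exact: left_span_sub (svalP s).
  by move=> x Ix; apply: contrapT => nsx; apply: nox; exists x.
have [p pP] := choice next.
have okS (s : {s : seq R | forall x, x \in s -> I x}) :
    forall x, x \in p s :: sval s -> I x.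
  by case: (pP s) => Ip _ x; rewrite inE => /predU1P[->//|/(svalP s)].
have ok0 x : x \in [::] -> I x by [].
pose s n := iter n (fun s => exist _ (p s :: sval s) (okS s)) (exist _ [::] ok0).
have [n0 n0P] : exists n0, forall n, (n0 <= n)%N ->
    left_span (sval (s n)) `<=` left_span (sval (s n0)).
  apply: accR => n; first exact: left_span_ideal.
  apply: left_span_sub; first exact: left_span_ideal.
  by move=> x xs; apply: left_span_gen; rewrite /= inE xs orbT.
case: (pP (s n0)) => _; apply; apply: (n0P n0.+1) => //.
by apply: left_span_gen; rewrite /= inE eqxx.
Qed.

Section Systems.
Variables (T : comPzRingType) (I : Type) (H : I -> I -> set T).

Definition prime_ideal (P : set T) : Prop :=
  [/\ left_ideal P, ~ P 1 & forall x y, P (x * y) -> P x \/ P y].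

(** H a c consists of the multipliers that carry the ideal at index a into the
    ideal at index c. *)
Definition system (X : I -> set T) : Prop :=
  (forall a, left_ideal (X a)) /\
  (forall a c h x, H a c h -> X a x -> X c (h * x)).

Definition acc_systems_over (Q : set T) : Prop :=
  forall X : nat -> I -> set T, (forall n, system (X n)) ->
  (forall n a, Q `<=` X n a) -> (forall n a, X n a `<=` X n.+1 a) ->
  exists n0, forall n, (n0 <= n)%N -> forall a, X n a `<=` X n0 a.

Definition ideal_join (Q : set T) (g : T) : set T :=
  [set x | exists y t, Q y /\ x = y + t * g].

Definition ideal_colon (Q : set T) (g : T) : set T := [set x | Q (x * g)].

Lemma ideal_join_ideal Q g : left_ideal Q -> left_ideal (ideal_join Q g).
Proof.
move=> [Q0 QD QM]; split.
- by exists 0, 0; rewrite mul0r addr0.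
- move=> _ _ [y [t [Qy ->]]] [y' [t' [Qy' ->]]]; exists (y + y'), (t + t').
  by split; [exact: QD|rewrite mulrDl addrACA].
- move=> a _ [y [t [Qy ->]]]; exists (a * y), (a * t).
  by split; [exact: QM|rewrite mulrDr mulrA].
Qed.

Lemma ideal_colon_ideal Q g : left_ideal Q -> left_ideal (ideal_colon Q g).
Proof.
move=> [Q0 QD QM]; rewrite /ideal_colon; split => /=.
- by rewrite mul0r.
- by move=> x y Qx Qy; rewrite mulrDl; apply: QD.
- by move=> a x Qx; rewrite -mulrA; apply: QM.
Qed.

Lemma sub_ideal_join Q g : Q `<=` ideal_join Q g.
Proof. by move=> x Qx; exists x, 0; rewrite mul0r addr0. Qed.

Lemma ideal_join_gen Q g : left_ideal Q -> ideal_join Q g g.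
Proof. by move=> [Q0 _ _]; exists 0, 1; rewrite add0r mul1r. Qed.

Lemma left_idealB (Q : set T) x y : left_ideal Q -> Q x -> Q y -> Q (x - y).
Proof.
move=> [_ QD QM] Qx Qy; apply: QD => //; rewrite -mulN1r; exact: QM.
Qed.

Lemma ideal_join_system X g : system X -> system (fun a => ideal_join (X a) g).
Proof.
move=> [X_ideal XH]; split=> [a|a c h _ Hh [y [t [Xy ->]]]].
  exact: ideal_join_ideal.
exists (h * y), (h * t); split; last by rewrite mulrDr mulrA.
exact: XH Hh Xy.
Qed.

Lemma ideal_colon_system X g :
  system X -> system (fun a => ideal_colon (X a) g).
Proof.
move=> [X_ideal XH]; split=> [a|a c h x Hh Xx]; first exact: ideal_colon_ideal.
by rewrite /ideal_colon /= -mulrA; apply: XH Hh Xx.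
Qed.

(** An element of X' lying in X + (g) differs from an element of X by a multiple
    t g, and t is in (X' : g). So X is determined, among larger systems, by
    X + (g) and (X : g). *)
Lemma acc_systems_extension Q g : left_ideal Q ->
  acc_systems_over (ideal_join Q g) -> acc_systems_over (ideal_colon Q g) ->
  acc_systems_over Q.
Proof.
move=> Q_ideal accJ accC X X_sys QX X_S.
have [n1 n1P] : exists n0, forall n, (n0 <= n)%N ->
    forall a, ideal_join (X n a) g `<=` ideal_join (X n0 a) g.
  apply: accJ => [n|n a _ [y [t [Qy ->]]]|n a _ [y [t [Xy ->]]]].
  - exact: ideal_join_system.
  - by exists y, t; split => //; apply: QX.
  - by exists y, t; split => //; apply: X_S.
have [n2 n2P] : exists n0, forall n, (n0 <= n)%N ->
    forall a, ideal_colon (X n a) g `<=` ideal_colon (X n0 a) g.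
  apply: accC => [n|n a x Qx|n a x Xx].
  - exact: ideal_colon_system.
  - exact: QX.
  - exact: X_S.
exists (maxn n1 n2) => n; rewrite geq_max => /andP[n1n n2n] a x Xnx.
have X_le := chain_le (fun n => X_S n a).
have [y [t [Xy xE]]] := n1P n n1n a x (@sub_ideal_join _ g x Xnx).
have tg : X n2 a (t * g).
  apply: (n2P n n2n a); rewrite /ideal_colon /=.
  have -> : t * g = x - y by rewrite xE addrC addKr.
  apply: left_idealB => //; first by case: (X_sys n).
  exact: X_le n1n y Xy.
have [_ XD _] := (X_sys (maxn n1 n2)).1 a.
rewrite xE; apply: XD.
  by apply: X_le Xy; apply: leq_maxl.
by apply: X_le tg; apply: leq_maxr.
Qed.

(** For a quasi-order this says that it is a well-quasi-order. *)
Definition good_pairs (r : I -> I -> Prop) : Prop :=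
  forall s : nat -> I, exists i j, (i < j)%N /\ r (s i) (s j).


(** Otherwise a greedy choice produces a sequence in L each term of which is
    above no earlier term, hence without a good pair. *)
Lemma finite_basis (r : I -> I -> Prop) (L : set I) : good_pairs r ->
  exists n (B : 'I_n -> I), (forall i, L (B i)) /\
    forall c, L c -> exists i, r (B i) c.
Proof.
move=> good; apply: contrapT => noB.
(* B holds the terms of the sequence chosen so far *)
pose ok (B : seq I) := forall a, List.In a B -> L a.
have next (B : {B | ok B}) : exists c,
    L c /\ forall a, List.In a (sval B) -> ~ r a c.
  apply: contrapT => noc; apply: noB.
  case: B noc => B okB /= noc.
  have inB (i : 'I_(size B)) : exists a, List.nth_error B i = Some a.
    elim: B i {okB noc} => [[]//|b B IHB] [[|i] /= lti]; first by exists b.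
    by have := IHB (Ordinal (lti : i < size B)%N).
  have [f fP] := choice inB; exists (size B), f; split.
    by move=> i; apply: okB; exact: List.nth_error_In (fP i).
  move=> c Lc; apply: contrapT => noi; apply: noc; exists c; split => // a Ba.
  have [k kP] := List.In_nth_error _ _ Ba.
  have ltk : (k < size B)%N.
    by apply/ssrnat.ltP; apply/List.nth_error_Some; rewrite kP.
  move=> rac; apply: noi; exists (Ordinal ltk).
  by have := fP (Ordinal ltk); rewrite /= kP => -[<-].
have [s sP] := choice next.
have ok0 : ok [::] by [].
have okS (B : {B | ok B}) : ok (s B :: sval B).
  by case: (sP B) => Ls _ a [<-//|]; exact: (svalP B).
pose B n := iter n (fun B => exist ok (s B :: sval B) (okS B)) (exist ok [::] ok0).
have [i [j [ij rij]]] := good (fun n => s (B n)).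
have inB k l : (k < l)%N -> List.In (s (B k)) (sval (B l)).
  elim: l => // l IHl; rewrite ltnS leq_eqVlt => /predU1P[->|/IHl kl].
    by left.
  by right.
by case: (sP (B j)) => _ /(_ _ (inB _ _ ij)).
Qed.


Lemma left_ideal_prod (Q : set T) n (F : 'I_n -> T) i :
  left_ideal Q -> Q (F i) -> Q (\prod_j F j).
Proof.
by move=> [_ _ QM] QFi; rewrite (bigD1 i) //= mulrC; apply: QM.
Qed.

Lemma prime_ideal_prod (P : set T) n (F : 'I_n -> T) :
  prime_ideal P -> (forall i, ~ P (F i)) -> ~ P (\prod_j F j).
Proof.
move=> [_ P1 PM] nPF; elim/big_ind: _ => // x y nPx nPy /PM[]//.
Qed.

Lemma acc_systems_over_all : acc_systems_over setT.
Proof. by move=> X _ QX _; exists 0%N => n _ a x _; apply: QX. Qed.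

(** The indices at which the ideals eventually leave P are all above finitely
    many of them. With x_a outside P in the ideal at such an a, the product z of the
    q_a x_a is outside P, and from some stage on it lies in all the ideals that
    are not in P. Over these indices the chain is pulled back from a chain over
    P + (z). *)
Lemma acc_systems_prime (P : set T) : prime_ideal P ->
  (exists2 r : I -> I -> Prop, good_pairs r &
    forall a, exists2 q, ~ P q & forall c, r a c -> H a c q) ->
  (forall g, ~ P g -> acc_systems_over (ideal_join P g)) ->
  acc_systems_over P.
Proof.
move=> Pprime [r good rH] accP X X_sys PX X_S; have [P_ideal P1 PM] := Pprime.
have X_le a := chain_le (fun n => X_S n a).
have [N [B [LB Bmin]]] :=
  finite_basis (fun a => exists n, ~ (X n a `<=` P)) good.
have [n_ n_P] := choice LB.
have xB i : exists x, X (n_ i) (B i) x /\ ~ P x.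
  by apply: contrapT => nox; apply: (n_P i) => x Xx; apply: contrapT => nPx;
     apply: nox; exists x.
have [x_ x_P] := choice xB.
have qB i : exists q, ~ P q /\ forall c, r (B i) c -> H (B i) c q.
  by have [q] := rH (B i); exists q.
have [q_ q_P] := choice qB.
pose z := \prod_i (q_ i * x_ i).
have nPz : ~ P z.
  apply: prime_ideal_prod => // i /PM[]; first by case: (q_P i).
  by case: (x_P i).
pose n0 := \max_i n_ i.
have Xz n c : (n0 <= n)%N -> (exists k, ~ (X k c `<=` P)) -> X n c z.
  move=> n0n /Bmin[i rBc]; apply: (left_ideal_prod (i := i)).
    exact: (X_sys n).1.
  apply: (X_sys n).2 (proj2 (q_P i) c rBc) _.
  apply: (X_le (B i) (n_ i)); first exact: leq_trans (leq_bigmax i) n0n.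
  by case: (x_P i).
have [n1 n1P] : exists n0, forall n, (n0 <= n)%N ->
    forall a, ideal_join (X n a) z `<=` ideal_join (X n0 a) z.
  apply: (accP z nPz) => [n|n a _ [y [t [Qy ->]]]|n a _ [y [t [Xy ->]]]].
  - exact: ideal_join_system.
  - by exists y, t; split => //; apply: PX.
  - by exists y, t; split => //; apply: X_S.
exists (maxn n0 n1) => n; rewrite geq_max => /andP[n0n n1n] c x Xnx.
have [Lc|nLc] := pselect (exists k, ~ (X k c `<=` P)); last first.
  apply: PX; apply: contrapT => nPx; apply: nLc; exists n => XP.
  exact: nPx (XP x Xnx).
have [y [t [Xy ->]]] := n1P n n1n c x (@sub_ideal_join _ z x Xnx).
have [_ XD XM] := (X_sys (maxn n0 n1)).1 c.
apply: XD; first by apply: X_le Xy; apply: leq_maxr.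
by apply: XM; apply: Xz => //; apply: leq_maxl.
Qed.

(** Noetherian induction: an ideal maximal among those over which the chain
    condition fails is prime by acc_systems_extension, which contradicts
    acc_systems_prime. *)
Theorem acc_systems : acc_ideals T ->
  (forall P, prime_ideal P -> exists2 r : I -> I -> Prop, good_pairs r &
    forall a, exists2 q, ~ P q & forall c, r a c -> H a c q) ->
  forall X : nat -> I -> set T, (forall n, system (X n)) ->
  (forall n a, X n a `<=` X n.+1 a) ->
  exists n0, forall n, (n0 <= n)%N -> forall a, X n a `<=` X n0 a.
Proof.
move=> accT primeH X X_sys X_S.
suff acc0 : acc_systems_over [set 0].
  by apply: acc0 => // n a _ ->; case: (X_sys n) => /(_ a)[].
apply: contrapT => bad0.
pose bad Q := left_ideal Q /\ ~ acc_systems_over Q.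
have ideal0 : left_ideal [set 0 : T].
  split=> //= [x y -> ->|a x ->]; first by rewrite addr0.
  by rewrite mulr0.
have [M [M_ideal badM] Mmax] : exists2 M, bad M &
    forall J, bad J -> M `<=` J -> J `<=` M.
  by apply: acc_maximal => // [J []//|]; exists [set 0].
have good J : left_ideal J -> M `<=` J -> ~ J `<=` M -> acc_systems_over J.
  by move=> J_ideal MJ nJM; apply: contrapT => badJ; apply: nJM; apply: Mmax.
have goodj g : ~ M g -> acc_systems_over (ideal_join M g).
  move=> nMg; apply: good; first exact: ideal_join_ideal.
    exact: sub_ideal_join.
  by move=> /(_ g (ideal_join_gen g M_ideal)).
have [M0 MD MM] := M_ideal.
have Mprime : prime_ideal M.
  split=> // [M1|x y Mxy].
    apply: badM; suff -> : M = setT by exact: acc_systems_over_all.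
    by apply/seteqP; split => // x _; rewrite -[x]mulr1; apply: MM.
  apply: contrapT => /not_orP[nMx nMy].
  apply: badM; apply: (acc_systems_extension (g := y)) => //; first exact: goodj.
  apply: good; first exact: ideal_colon_ideal.
    by move=> u Mu; rewrite /ideal_colon /= mulrC; apply: MM.
  by move=> /(_ x Mxy).
by apply: badM; apply: acc_systems_prime => //; apply: primeH.
Qed.

End Systems.

(** Hilbert's basis theorem. The coefficients of degree k of the polynomials of
    degree at most k in an ideal form a system indexed by k, for which 1 is a
    multiplier from k to every l >= k, through multiplication by X^(l - k). *)
Lemma acc_ideals_poly (R : comNzRingType) :
  acc_ideals R -> acc_ideals {poly R}.
Proof.
move=> accR J J_ideal J_S.
pose L n k : set R := [set c | exists2 p, J n p & (size p <= k.+1)%N /\ p`_k = c].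
have JB n p q : J n p -> J n q -> J n (p - q).
  have [_ JD JM] := J_ideal n.
  by move=> Jp Jq; apply: JD => //; rewrite -mulN1r; apply: JM.
have [n0 n0P] : exists n0, forall n, (n0 <= n)%N -> forall k, L n k `<=` L n0 k.
  apply: (@acc_systems _ _ (fun k l => [set h : R | (k <= l)%N /\ h = 1])) => //.
  - move=> P [_ P1 _]; exists (fun k l => (k <= l)%N); last by move=> k; exists 1.
    move=> s; apply: contrapT => nos.
    have dec i j : (i < j)%N -> (s j < s i)%N.
      move=> ij; rewrite ltnNge; apply/negP => sij; apply: nos.
      by exists i, j.
    have : forall i, (s i + i <= s 0%N)%N.
      by elim=> [|i IHi]; [rewrite addn0|have := dec i i.+1 (leqnn _); lia].
    by move=> /(_ (s 0%N).+1); lia.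
  - move=> n; have [J0 JD JM] := J_ideal n; split=> [k|k l _ c [kl ->]].
      split.
      + by exists 0 => //; rewrite size_poly0 coef0.
      + move=> _ _ [p Jp [sp <-]] [q Jq [sq <-]]; exists (p + q); first exact: JD.
        rewrite coefD; split=> //; apply: leq_trans (size_polyD _ _) _.
        by rewrite geq_max sp.
      + move=> a _ [p Jp [sp <-]]; exists (a%:P * p); first exact: JM.
        by rewrite mul_polyC coefZ (leq_trans (size_scale_leq _ _)).
    move=> [p Jp [sp <-]]; exists ('X^(l - k) * p); first exact: JM.
    rewrite mulrC coefMXn ltnNge leq_subr /= subKn // mul1r; split=> //.
    apply: leq_trans (size_polyMleq _ _) _; rewrite size_polyXn addnS /=.
    by apply: leq_trans (leq_add sp (leqnn _)) _; rewrite addSn subnKC.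
  - by move=> n k c [p Jp pP]; exists p => //; apply: J_S.
exists n0 => n n0n p; have [k] := ubnP (size p).
elim: k p => // k IHk p; rewrite ltnS leq_eqVlt => /predU1P[sp|/IHk//] Jp.
have [J0 JD _] := J_ideal n0.
case: k IHk sp => [_ /eqP|k IHk sp]; first by rewrite size_poly_eq0 => /eqP->.
have [|q Jq [sq qk]] := n0P n n0n k p`_k.
  by exists p => //; rewrite sp.
rewrite -(subrK q p); apply: JD => //; apply: IHk; last first.
  by apply: JB => //; apply: (chain_le J_S n0n).
rewrite ltnS; apply/leq_sizeP => j; rewrite leq_eqVlt coefB => /predU1P[<-|kj].
  by rewrite qk subrr.
by rewrite !nth_default ?subrr // (leq_trans _ kj) // sp.
Qed.

Lemma acc_ideals_field (K : fieldType) : acc_ideals K.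
Proof.
move=> J J_ideal J_S.
have [[n [c Jc c0]]|no] := pselect (exists n, exists2 c, J n c & c != 0).
  exists n => k nk x _; have [_ _ JM] := J_ideal n.
  by rewrite -(divfK c0 x); apply: JM.
exists 0%N => n _ x Jx; have [J0 _ _] := J_ideal 0%N.
have [->//|x0] := eqVneq x 0; by case: no; exists n, x.
Qed.

Lemma acc_ideals_surj (R T : pzRingType) (f : {rmorphism R -> T}) :
  (forall y, exists x, f x = y) -> acc_ideals R -> acc_ideals T.
Proof.
move=> f_surj accR J J_ideal J_S.
have [n0 n0P] : exists n0, forall n, (n0 <= n)%N ->
    [set x | J n (f x)] `<=` [set x | J n0 (f x)].
  apply: accR => n; last by move=> x; apply: J_S.
  have [J0 JD JM] := J_ideal n; split=> /= [|x y|a x].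
  - by rewrite rmorph0.
  - by rewrite rmorphD; apply: JD.
  - by rewrite rmorphM; apply: JM.
by exists n0 => n n0n y; have [x <-] := f_surj y; apply: n0P.
Qed.

(** The generators are adjoined one by one, by acc_ideals_poly. *)
Lemma acc_ideals_fin_gen (K : fieldType) (T : comNzRingType)
    (f : {rmorphism K -> T}) (xs : seq T) :
  exists (R : comNzRingType) (g : {rmorphism R -> T}),
  [/\ acc_ideals R, forall c, exists p, g p = f c
    & forall x, x \in xs -> exists p, g p = x].
Proof.
elim: xs => [|x xs [R [g [accR gK gxs]]]].
  exists K, f; split=> // [|c]; first exact: acc_ideals_field.
  by exists c.
have cgx : commr_rmorph g x by move=> y; apply: mulrC.
exists {poly R}, (horner_morph cgx); split; first exact: acc_ideals_poly.
  by move=> c; have [p <-] := gK c; exists p%:P; exact: horner_morphC.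
move=> y; rewrite inE => /predU1P[->|/gxs[p <-]].
  by exists 'X; exact: horner_morphX.
by exists p%:P; exact: horner_morphC.
Qed.

(** * Lattice generators and integer linear forms *)

Section Lattice.
Variable d : nat.
Implicit Types (A : {fset 'rV[int]_d}) (u : 'cV[int]_d) (x y : 'rV[int]_d).

Lemma NN0 A : NN A 0.
Proof. by exists (fun=> 0%N); rewrite big1. Qed.

Lemma NND A x y : NN A x -> NN A y -> NN A (x + y).
Proof.
move=> [c ->] [c' ->]; exists (fun a => c a + c' a)%N.
by rewrite -big_split; apply: eq_bigr => a _; rewrite mulrnDr.
Qed.

Lemma NN_gen A a : a \in A -> NN A a.
Proof.
move=> aA; exists (fun a' => (a' == a)); rewrite (big_fsetD1 a) //= eqxx.
rewrite big_seq big1 ?addr0 // => a'.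
by rewrite in_fsetD1 => /andP[/negPf-> _].
Qed.

Lemma NNMn A x n : NN A x -> NN A (x *+ n).
Proof.
move=> Ax; elim: n => [|n IHn]; first exact: NN0.
by rewrite mulrS; apply: NND.
Qed.

Lemma ZZ0 A : ZZ A 0.
Proof. by exists (fun=> 0); rewrite big1. Qed.

Lemma ZZB A x y : ZZ A x -> ZZ A y -> ZZ A (x - y).
Proof.
move=> [c ->] [c' ->]; exists (fun a => c a - c' a).
by rewrite -sumrB; apply: eq_bigr => a _; rewrite mulrzBr.
Qed.

Lemma ZZN A x : ZZ A x -> ZZ A (- x).
Proof. by move=> Ax; rewrite -sub0r; apply: ZZB => //; exact: ZZ0. Qed.

Lemma ZZD A x y : ZZ A x -> ZZ A y -> ZZ A (x + y).
Proof. by move=> Ax Ay; rewrite -[y]opprK; apply: ZZB => //; exact: ZZN. Qed.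

Lemma ZZMn A x n : ZZ A x -> ZZ A (x *+ n).
Proof.
move=> Ax; elim: n => [|n IHn]; first exact: ZZ0.
by rewrite mulrS; apply: ZZD.
Qed.

Lemma NN_ZZ A x : NN A x -> ZZ A x.
Proof. by move=> [c ->]; exists (fun a => (c a)%:Z). Qed.

Lemma rowMzE x n i : (x *~ n) 0 i = x 0 i * n.
Proof. by rewrite -scaler_int mxE intz mulrC. Qed.

Definition lform u x : int := (x *m u) 0 0.

Lemma lformD u x y : lform u (x + y) = lform u x + lform u y.
Proof. by rewrite /lform mulmxDl mxE. Qed.

Lemma lformN u x : lform u (- x) = - lform u x.
Proof. by rewrite /lform mulNmx mxE. Qed.

Lemma lformB u x y : lform u (x - y) = lform u x - lform u y.
Proof. by rewrite lformD lformN. Qed.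

Lemma lform0 u : lform u 0 = 0.
Proof. by rewrite /lform mul0mx mxE. Qed.

Lemma lformMn u x n : lform u (x *+ n) = lform u x *+ n.
Proof. by elim: n => [|n IHn]; rewrite ?lform0 // !mulrS lformD IHn. Qed.

Lemma lformMz u x n : lform u (x *~ n) = lform u x * n.
Proof.
case: n => n; first by rewrite -pmulrn lformMn -mulr_natr natz.
by rewrite NegzE mulrNz -pmulrn lformN lformMn mulrN -mulr_natr natz.
Qed.

Lemma lform_sum u (s : seq 'rV[int]_d) (F : 'rV[int]_d -> 'rV[int]_d) :
  lform u (\sum_(a <- s) F a) = \sum_(a <- s) lform u (F a).
Proof.
by elim: s => [|a s IHs]; rewrite ?big_nil ?lform0 // !big_cons lformD IHs.
Qed.

Lemma lform_ZZ u A x :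
  (forall a, a \in A -> lform u a = 0) -> ZZ A x -> lform u x = 0.
Proof.
move=> uA [c ->]; rewrite lform_sum big_seq big1 // => a aA.
by rewrite lformMz uA ?mul0r.
Qed.

End Lattice.

(** * Polynomial functions on the lattice *)

Section PolynomialFunctions.
Variables (K : fieldType) (d : nat).

(** The algebra K[s_1, ..., s_d], seen through its values on the lattice, where
    it is faithful in characteristic zero. *)
Inductive polyfun : ('rV[int]_d -> K) -> Prop :=
| polyfunC c : polyfun (fun=> c)
| polyfunX (i : 'I_d) : polyfun (fun x => (x 0 i)%:~R)
| polyfunD f g : polyfun f -> polyfun g -> polyfun (fun x => f x + g x)
| polyfunM f g : polyfun f -> polyfun g -> polyfun (fun x => f x * g x).

Definition polyfunb := [pred f | `[< polyfun f >]].

Fact polyfunb_subring_closed : subring_closed polyfunb.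
Proof.
split; first by apply/asboolP; exact: polyfunC.
  move=> f g /asboolP pf /asboolP pg; apply/asboolP.
  suff -> : f - g = (fun x => f x + (-1) * g x).
    by apply: polyfunD => //; apply: polyfunM => //; exact: polyfunC.
  by apply/funext => x; rewrite mulN1r.
by move=> f g /asboolP pf /asboolP pg; apply/asboolP; exact: polyfunM.
Qed.

HB.instance Definition _ := GRing.isSubringClosed.Build ('rV[int]_d -> K)
  polyfunb polyfunb_subring_closed.

Record polyring : predArgType :=
  PolyRing { pval :> 'rV[int]_d -> K; pval_in : pval \in polyfunb }.

HB.instance Definition _ := [isSub for pval].
HB.instance Definition _ := [Choice of polyring by <:].
HB.instance Definition _ :=
  GRing.SubChoice_isSubComPzRing.Build ('rV[int]_d -> K) polyfunb polyring
    polyfunb_subring_closed.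

Fact polyring_oner_neq0 : 1 != 0 :> polyring.
Proof.
apply/eqP => /(congr1 val); rewrite rmorph1 rmorph0 => /(congr1 (@^~ 0)) /eqP.
by rewrite oner_eq0.
Qed.

HB.instance Definition _ :=
  GRing.PzSemiRing_isNonZero.Build polyring polyring_oner_neq0.

Lemma pvalP (f : polyring) : polyfun f.
Proof. exact/asboolP/pval_in. Qed.

Definition to_polyring f (pf : polyfun f) : polyring := PolyRing (asboolT pf).

Lemma polyring_eq (f g : polyring) : f =1 g -> f = g.
Proof. by move=> fg; apply/val_inj/funext. Qed.

Definition polyring_const (c : K) : polyring := to_polyring (polyfunC c).

Fact polyring_const_zmod_morphism : zmod_morphism polyring_const.
Proof. by move=> x y; apply: polyring_eq. Qed.

Fact polyring_const_monoid_morphism : monoid_morphism polyring_const.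
Proof. by split=> [|x y]; apply: polyring_eq. Qed.

HB.instance Definition _ := GRing.isZmodMorphism.Build K polyring
  polyring_const polyring_const_zmod_morphism.
HB.instance Definition _ := GRing.isMonoidMorphism.Build K polyring
  polyring_const polyring_const_monoid_morphism.

Lemma acc_ideals_polyring : acc_ideals polyring.
Proof.
have [R [g [accR gK gX]]] := acc_ideals_fin_gen
  polyring_const [seq to_polyring (polyfunX i) | i <- enum 'I_d].
apply: (acc_ideals_surj (f := g)) accR => f.
suff H h : polyfun h -> exists p, g p = h :> (_ -> _).
  have [p gp] := H _ (pvalP f).
  by exists p; apply: val_inj.
elim=> [c|i|f1 f2 _ [p1 <-] _ [p2 <-]|f1 f2 _ [p1 <-] _ [p2 <-]].
- by have [p gp] := gK c; exists p; rewrite gp.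
- have [|p gp] := gX (to_polyring (polyfunX i)); last by exists p; rewrite gp.
  by apply: map_f; rewrite mem_enum.
- by exists (p1 + p2); rewrite rmorphD.
- by exists (p1 * p2); rewrite rmorphM.
Qed.

Lemma polyfun_sum (J : Type) (s : seq J) (F : J -> 'rV[int]_d -> K) :
  (forall j, polyfun (F j)) -> polyfun (fun x => \sum_(j <- s) F j x).
Proof.
move=> pF; elim: s => [|j s IHs].
  have -> : (fun x => \sum_(j <- [::]) F j x) = fun=> 0.
    by apply/funext => x; rewrite big_nil.
  exact: polyfunC.
have -> : (fun x => \sum_(j <- j :: s) F j x) =
    fun x => F j x + \sum_(j <- s) F j x.
  by apply/funext => x; rewrite big_cons.
exact: polyfunD.
Qed.

Lemma polyfun_prod (J : Type) (s : seq J) (F : J -> 'rV[int]_d -> K) :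
  (forall j, polyfun (F j)) -> polyfun (fun x => \prod_(j <- s) F j x).
Proof.
move=> pF; elim: s => [|j s IHs].
  have -> : (fun x => \prod_(j <- [::]) F j x) = fun=> 1.
    by apply/funext => x; rewrite big_nil.
  exact: polyfunC.
have -> : (fun x => \prod_(j <- j :: s) F j x) =
    fun x => F j x * \prod_(j <- s) F j x.
  by apply/funext => x; rewrite big_cons.
exact: polyfunM.
Qed.

Lemma polyfunB f g : polyfun f -> polyfun g -> polyfun (fun x => f x - g x).
Proof.
move=> pf pg; have -> : (fun x => f x - g x) = (fun x => f x + (-1) * g x).
  by apply/funext => x; rewrite mulN1r.
by apply: polyfunD => //; apply: polyfunM => //; exact: polyfunC.
Qed.

Lemma polyfun_lform (u : 'cV[int]_d) (m : int) :
  polyfun (fun x => (lform u x - m)%:~R).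
Proof.
have -> : (fun x => (lform u x - m)%:~R) =
    fun x => \sum_i (u i 0)%:~R * (x 0 i)%:~R - m%:~R :> K.
  apply/funext => x; rewrite rmorphB /= /lform mxE rmorph_sum /=; congr (_ - _).
  by apply: eq_bigr => i _; rewrite rmorphM mulrC.
apply: polyfunB; last exact: polyfunC.
apply: polyfun_sum => i; apply: polyfunM; [exact: polyfunC|exact: polyfunX].
Qed.

Lemma polyfun_shift a f : polyfun f -> polyfun (fun x => f (x + a)).
Proof.
elim=> [c|i|f1 f2 _ p1 _ p2|f1 f2 _ p1 _ p2].
- exact: polyfunC.
- have -> : (fun x => ((x + a) 0 i)%:~R) =
      fun x => (x 0 i)%:~R + (a 0 i)%:~R :> K.
    by apply/funext => x; rewrite mxE rmorphD.
  by apply: polyfunD; [exact: polyfunX|exact: polyfunC].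
- exact: polyfunD.
- exact: polyfunM.
Qed.

(** If u e = 1, then x |-> x - (u x - m) e is a retraction of the lattice onto
    the hyperplane u = m, congruent to the identity modulo u - m. *)
Lemma polyfun_retract u m (e : 'rV[int]_d) f : polyfun f ->
  exists2 g, polyfun g &
    forall x, f x = f (x - e *~ (lform u x - m)) + (lform u x - m)%:~R * g x.
Proof.
elim=> [c|i|f1 f2 p1 [g1 pg1 f1E] p2 [g2 pg2 f2E]
  |f1 f2 p1 [g1 pg1 f1E] p2 [g2 pg2 f2E]].
- by exists (fun=> 0) => [|x]; [exact: polyfunC|rewrite mulr0 addr0].
- exists (fun=> (e 0 i)%:~R) => [|x]; first exact: polyfunC.
  rewrite -rmorphM -rmorphD; congr (_%:~R).
  by rewrite !mxE rowMzE mulrC addrNK.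
- exists (fun x => g1 x + g2 x) => [|x]; first exact: polyfunD.
  by rewrite f1E f2E mulrDr addrACA.
- exists (fun x => g1 x * f2 x + (f1 x - (lform u x - m)%:~R * g1 x) * g2 x).
    apply: polyfunD; apply: polyfunM => //.
    by apply: polyfunB => //; apply: polyfunM => //; exact: polyfun_lform.
  by move=> x; rewrite (f1E x) (f2E x); ring.
Qed.

Lemma polyfun_line x y f : polyfun f ->
  exists p : {poly K}, forall n : int, f (x + y *~ n) = p.[n%:~R].
Proof.
elim=> [c|i|f1 f2 _ [p1 E1] _ [p2 E2]|f1 f2 _ [p1 E1] _ [p2 E2]].
- by exists c%:P => n; rewrite hornerC.
- exists ((x 0 i)%:~R%:P + (y 0 i)%:~R *: 'X) => n.
  rewrite hornerD hornerC hornerZ hornerX -rmorphM -rmorphD; congr (_%:~R).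
  by rewrite !mxE rowMzE.
- by exists (p1 + p2) => n; rewrite E1 E2 hornerD.
- by exists (p1 * p2) => n; rewrite E1 E2 hornerM.
Qed.

Hypothesis K0 : [pchar K] =i pred0.

Lemma intr_inj_pchar0 : injective (fun n : int => n%:~R : K).
Proof.
move=> n n' /eqP; rewrite -subr_eq0 -rmorphB /= => /eqP nn'.
apply/eqP; rewrite -subr_eq0; move: nn'; set k := n - n'.
have nat0 j : j%:R = 0 :> K -> j = 0%N.
  by move=> /eqP; rewrite ((pcharf0P K).1 K0) => /eqP.
case: k => j; rewrite ?NegzE ?rmorphN /=; first by rewrite -pmulrn => /nat0->.
by move=> /eqP; rewrite oppr_eq0 -pmulrn => /eqP/nat0.
Qed.

Lemma poly_nat_roots (p : {poly K}) k :
  (0 < k)%N -> (forall n : nat, p.[(k * n)%:R] = 0) -> p = 0.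
Proof.
move=> k0 rp; apply/eqP; apply: contraT => p0.
pose rs := [seq (k * n)%:R : K | n <- iota 0 (size p)].
have /(max_poly_roots p0) : all (root p) rs.
  by apply/allP => _ /mapP[n _ ->]; apply/eqP; exact: rp.
rewrite map_inj_uniq ?iota_uniq ?size_map ?size_iota ?ltnn //; first exact.
move=> n n' /(@intr_inj_pchar0 (k * n)%N (k * n')%N) [] /eqP.
by rewrite eqn_pmul2l // => /eqP.
Qed.

(** On a line f is a polynomial in one variable, with infinitely many roots. *)
Lemma polyfun_line_vanish x y f k : (0 < k)%N -> polyfun f ->
  (forall n : nat, f (x + y *+ (k * n)) = 0) ->
  forall n : int, f (x + y *~ n) = 0.
Proof.
move=> k0 /(polyfun_line x y)[p fE] f0 n; rewrite fE.
rewrite (poly_nat_roots k0 (p := p)) ?horner0 // => j.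
by have := fE (k * j)%N; rewrite -!pmulrn f0.
Qed.

(** On a line f and g become elements of the domain K[X], and f is nonzero. *)
Lemma polyfun_line_cancel x y f g : polyfun f -> polyfun g ->
  (forall n : int, f (x + y *~ n) * g (x + y *~ n) = 0) ->
  (exists n : int, f (x + y *~ n) != 0) -> g x = 0.
Proof.
move=> /(polyfun_line x y)[p fE] /(polyfun_line x y)[q gE] fg0 [n].
rewrite fE => pn; have pq : p * q = 0.
  apply: (@poly_nat_roots _ 1) => // j; rewrite mul1n hornerM.
  by have := fg0 j; rewrite fE gE -!pmulrn.
have := gE 0; rewrite mulr0z addr0 => ->.
move/eqP: pq; rewrite mulf_eq0 => /orP[/eqP p0|/eqP->]; last by rewrite horner0.
by rewrite p0 horner0 eqxx in pn.
Qed.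

Lemma polyfun_vanish_ZZ x f (B : {fset 'rV[int]_d}) : polyfun f ->
  (forall y, NN B y -> f (x + y) = 0) -> forall y, ZZ B y -> f (x + y) = 0.
Proof.
move=> pf fB y [c ->].
suff H (s : seq 'rV[int]_d) : {subset s <= B} ->
    forall y, NN B y -> f (x + (y + \sum_(a <- s) a *~ c a)) = 0.
  by have := H (enum_fset B) (fun _ => id) 0 (NN0 B); rewrite add0r.
elim: s => [_ {}y By|a s IHs sB {}y By]; first by rewrite big_nil addr0 fB.
rewrite big_cons (addrC (a *~ _)) !addrA.
apply: (@polyfun_line_vanish _ a f 1) => // n; rewrite mul1n.
rewrite -!addrA (addrC _ (a *+ n)) (addrA y); apply: IHs.
  by move=> a' a's; apply: sB; rewrite inE a's orbT.
apply: NND => //; apply: NNMn; apply: NN_gen; apply: sB.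
by rewrite inE eqxx.
Qed.

(** The translates x + N B are Zariski dense in the hyperplane: being dense
    along each line, N B may be replaced by Z B, and then by the lattice of all
    directions of the hyperplane, in which Z B has finite exponent. *)
Lemma polyfun_vanish_hyperplane u m x f (B : {fset 'rV[int]_d}) : polyfun f ->
  lform u x = m ->
  (forall y, lform u y = 0 -> exists2 k, (0 < k)%N & ZZ B (y *+ k)) ->
  (forall y, NN B y -> f (x + y) = 0) ->
  forall y, lform u y = m -> f y = 0.
Proof.
move=> pf ux uB fB y uy; have [|k k0 kB] := uB (y - x).
  by rewrite lformB uy ux subrr.
have := @polyfun_line_vanish x (y - x) f k k0 pf _ 1.
rewrite mulr1z (addrC x) subrK; apply=> n; rewrite mulrnA.
by apply: (polyfun_vanish_ZZ pf fB); exact: ZZMn.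
Qed.

(** f is congruent, modulo u - m, to its composite with the retraction onto the
    hyperplane, which is zero. *)
Lemma polyfun_hyperplane_dvd u m (e : 'rV[int]_d) f : lform u e = 1 ->
  polyfun f -> (forall y, lform u y = m -> f y = 0) ->
  exists2 g, polyfun g & forall x, f x = (lform u x - m)%:~R * g x.
Proof.
move=> ue /(@polyfun_retract u m e)[g pg fE] f0; exists g => // x.
rewrite fE f0 ?add0r // lformB lformMz ue mul1r.
by rewrite opprB addrC subrK.
Qed.

(** The quotient of f by the first factor still vanishes on the other
    hyperplanes, because each of their points lies on a line of the hyperplane
    on which the first factor is not identically zero. *)
Lemma polyfun_prod_dvd (L : seq ('cV[int]_d * int)) f : uniq L ->
  (forall p, p \in L -> exists e, lform p.1 e = 1) ->
  (forall p q, p \in L -> q \in L -> p.1 != q.1 ->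
     exists2 y, lform q.1 y = 0 & lform p.1 y != 0) ->
  polyfun f ->
  (forall p x, p \in L -> lform p.1 x = p.2 -> f x = 0) ->
  exists2 g, polyfun g &
    forall x, f x = (\prod_(p <- L) (lform p.1 x - p.2)%:~R) * g x.
Proof.
elim: L f => [|p L IHL] f; first by exists f => // x; rewrite big_nil mul1r.
rewrite cons_uniq => /andP[pL uL] surjL indepL pf f0.
have inL q : q \in L -> q \in p :: L by rewrite inE orbC => ->.
have pin : p \in p :: L by rewrite inE eqxx.
have [e pe] := surjL p pin.
have [|h ph fE] := polyfun_hyperplane_dvd (m := p.2) pe pf.
  by move=> y; apply: f0.
have h0 q x : q \in L -> lform q.1 x = q.2 -> h x = 0.
  move=> qL qx; have fq0 := fun y => f0 q y (inL q qL).
  have [pq|pq] := eqVneq p.1 q.1.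
    have /eqP := fq0 x qx; rewrite fE mulf_eq0 => /orP[|/eqP//].
    rewrite -(rmorph0 intr) => /eqP /intr_inj_pchar0 /eqP.
    rewrite pq qx subr_eq0 eq_sym => /eqP pq2; case/negP: pL.
    by rewrite [p]surjective_pairing pq pq2 -surjective_pairing.
  have [y qy py] := indepL p q pin (inL q qL) pq.
  apply: (polyfun_line_cancel (y := y) (polyfun_lform p.1 p.2) ph) => [n|].
    by rewrite -fE fq0 // lformD lformMz qy mul0r addr0.
  have neq0 n : lform p.1 (x + y *~ n) - p.2 != 0 ->
      exists n, (lform p.1 (x + y *~ n) - p.2)%:~R != 0 :> K.
    move=> nz; exists n; apply: contra nz => /eqP.
    by rewrite -(rmorph0 intr) => /intr_inj_pchar0 /eqP.
  have [x0|] := eqVneq (lform p.1 (x + y *~ 0) - p.2) 0; last exact: neq0.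
  apply: (neq0 1); rewrite mulr1z lformD addrAC.
  by move: x0; rewrite mulr0z addr0 => ->; rewrite add0r.
have [g pg hE] := IHL h uL (fun q qL => surjL q (inL q qL))
  (fun q q' qL q'L => indepL q q' (inL q qL) (inL q' q'L)) ph h0.
by exists g => // x; rewrite fE hE big_cons mulrA.
Qed.

End PolynomialFunctions.

(** * Relations with infinite increasing subsequences *)

Section Perfect.

(** Stronger in form than good_pairs, and stable under conjunction because
    subsequences can be extracted successively. *)
Definition perfect (I : Type) (r : I -> I -> Prop) : Prop :=
  forall s : nat -> I, exists2 g : nat -> nat,
    {homo g : i j / (i < j)%N} & forall i j, (i < j)%N -> r (s (g i)) (s (g j)).

Lemma perfect_good_pairs (I : Type) (r : I -> I -> Prop) :
  perfect r -> good_pairs r.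
Proof.
move=> r_perf s; have [g g_mono rg] := r_perf s.
by exists (g 0%N), (g 1%N); split; [exact: g_mono|exact: rg].
Qed.

Lemma perfect_sub (I : Type) (r r' : I -> I -> Prop) :
  (forall a c, r a c -> r' a c) -> perfect r -> perfect r'.
Proof.
move=> rr' r_perf s; have [g g_mono rg] := r_perf s.
by exists g => // i j /rg/rr'.
Qed.

Lemma perfect_comap (I J : Type) (f : I -> J) (r : J -> J -> Prop) :
  perfect r -> perfect (fun a c => r (f a) (f c)).
Proof. by move=> r_perf s; have [g] := r_perf (f \o s); exists g. Qed.

Lemma perfect_and (I : Type) (r r' : I -> I -> Prop) :
  perfect r -> perfect r' -> perfect (fun a c => r a c /\ r' a c).
Proof.
move=> r_perf r'_perf s; have [g g_mono rg] := r_perf s.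
have [h h_mono r'h] := r'_perf (s \o g); exists (g \o h) => i j ij /=.
  by apply/g_mono/h_mono.
by split; [apply/rg/h_mono|apply: r'h].
Qed.

Lemma perfect_all (I : Type) (X : eqType) (L : seq X)
    (r : X -> I -> I -> Prop) :
  (forall x, x \in L -> perfect (r x)) ->
  perfect (fun a c => forall x, x \in L -> r x a c).
Proof.
elim: L => [_|x L IHL rL]; first by move=> s; exists id.
apply: (@perfect_sub _ (fun a c =>
    r x a c /\ forall y, y \in L -> r y a c)).
  by move=> a c [rx ry] y; rewrite inE => /predU1P[->//|]; exact: ry.
apply: perfect_and; first by apply: rL; rewrite inE eqxx.
by apply: IHL => y yL; apply: rL; rewrite inE yL orbT.
Qed.

Lemma subsequence (P : nat -> nat -> Prop) :
  (forall N, exists2 k, (N <= k)%N & P N k) ->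
  exists2 g : nat -> nat, {homo g : i j / (i < j)%N} &
    exists N : nat -> nat, (forall i j, (i < j)%N -> (N i <= g j)%N) /\
    forall i, P (N i) (g i).
Proof.
move=> infP.
have ex N : exists k, (N <= k)%N /\ P N k by have [k] := infP N; exists k.
have [m mP] := choice ex.
pose g i := iter i (fun k => m k.+1) (m 0%N).
pose N i := if i is i'.+1 then (g i').+1 else 0%N.
have gE i : g i = m (N i) by case: i.
have g_mono : {homo g : i j / (i < j)%N}.
  apply: homo_ltn => [? ? ?|i]; first exact: ltn_trans.
  by have [] := mP (g i).+1.
exists g => //; exists N; split=> [i j ij|i]; last first.
  by rewrite gE; have [] := mP (N i).
case: i ij => // i ij; apply: g_mono; exact: ltn_trans ij.
Qed.

Lemma perfect_leq : perfect (fun m n => (m <= n)%N).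
Proof.
move=> s.
have [|g g_mono [N [Ng gP]]] :=
  @subsequence (fun N k => forall l, (N <= l)%N -> (s k <= s l)%N).
  move=> N; have ex : exists n, `[< exists2 k, (N <= k)%N & s k = n >].
    by exists (s N); apply/asboolP; exists N.
  case: (ex_minnP ex) => n /asboolP[k Nk <-] nmin; exists k => // l Nl.
  by apply: nmin; apply/asboolP; exists l.
by exists g => // i j ij; apply/gP/Ng.
Qed.

Lemma perfect_eq_fin (F : finType) : perfect (@eq F).
Proof.
move=> s.
have [c infc] : exists c, forall N, exists2 k, (N <= k)%N & s k = c.
  apply: contrapT => noc.
  have bound c : exists N, forall k, (N <= k)%N -> s k <> c.
    apply: contrapT => noN; apply: noc; exists c => N.
    apply: contrapT => nok; apply: noN; exists N => k Nk skc.
    by apply: nok; exists k.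
  have [N NP] := choice bound; pose M := (\max_c N c)%N.
  exact: (NP (s M) M (leq_bigmax (s M))).
have [g g_mono [N [_ gc]]] := subsequence infc.
by exists g => // i j _; rewrite !gc.
Qed.

(** The threshold C makes long steps jump over the gaps of a set of levels, and
    relates values close to the origin to themselves only. *)
Definition step (C : nat) (n n' : int) : Prop :=
  n' = n \/ (C%:Z <= n /\ C%:Z <= n' - n) \/ (n <= - C%:Z /\ n' - n <= - C%:Z).

(** Once the sign, the residue modulo C and the alternative between small and
    large absolute value are fixed, only the quotients by C are to be compared. *)
Lemma perfect_step C : perfect (step C.+1).
Proof.
pose cls (n : int) := (0 <= n, (`|n|%N < C.+1)%N,
  inord (`|n|%N %% C.+1)%N : 'I_C.+1).
apply: (@perfect_sub _ (fun n n' : int =>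
  cls n = cls n' /\ (`|n|%N %/ C.+1 <= `|n'|%N %/ C.+1)%N)).
  move=> n n' [[sn ln rn] qn]; rewrite /step.
  have {rn} : (`|n|%N %% C.+1 = `|n'|%N %% C.+1)%N.
    by move/(congr1 val): rn; rewrite /= !inordK ?ltn_mod.
  have := divn_eq `|n|%N C.+1; have := divn_eq `|n'|%N C.+1.
  move: ln qn; set q := (_ %/ _)%N; set q' := (_ %/ _)%N => ln qn En' En rn.
  move: En'; rewrite -rn; move: En; set r := (_ %% _)%N => En En'.
  have [lt|ge] := ltnP `|n|%N C.+1.
    left; move: (lt); rewrite ln => lt'.
    have q0 : q = 0%N by apply/eqP; rewrite -leqn0 -ltnS ltn_divLR // mul1n.
    have q'0 : q' = 0%N by apply/eqP; rewrite -leqn0 -ltnS ltn_divLR // mul1n.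
    rewrite q0 q'0 in En En'; lia.
  have [leq|ltq] := leqP q' q.
    have eqq : q' = q by apply/eqP; rewrite eqn_leq leq qn.
    left; rewrite eqq in En'; lia.
  right; have : (q * C.+1 + C.+1 <= q' * C.+1)%N by rewrite -mulSnr leq_mul2r ltq orbT.
  lia.
apply: perfect_and.
  exact: (perfect_comap cls (@perfect_eq_fin _)).
exact: (perfect_comap (fun n : int => `|n|%N %/ C.+1)%N perfect_leq).
Qed.

Lemma perfect_congr d C : perfect (fun a c : 'rV[int]_d =>
  exists y, c - a = y *+ C.+1).
Proof.
pose md (i : 'I_d) (a : 'rV[int]_d) := modz (a 0 i) C.+1.
pose cls i a : 'I_C.+1 := inord (`|md i a|%N).
suff: perfect (fun a c => forall i, i \in enum 'I_d -> cls i a = cls i c).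
  apply: perfect_sub.
  move=> a c ac; exists (\row_i divz (c 0 i - a 0 i) C.+1).
  apply/rowP => i; have /(congr1 val) := ac i (mem_enum _ i).
  have lt (x : int) : (`|(x %% C.+1)%Z| < C.+1)%N.
    by have := ltz_pmod x (isT : 0 < C.+1%:Z); have := modz_ge0 x (isT : C.+1%:Z != 0); lia.
  rewrite /= /md !inordK ?lt // => eqr.
  rewrite -[_ *+ _]scaler_nat !mxE natz.
  have /dvdzP[q ->] : (C.+1 %| (c 0 i - a 0 i)%R)%Z.
    rewrite -eqz_mod_dvd; apply/eqP.
    have := modz_ge0 (a 0 i) (isT : C.+1%:Z != 0).
    have := modz_ge0 (c 0 i) (isT : C.+1%:Z != 0).
    by move: eqr; rewrite /md; move: (modz _ _) (modz _ _) => x y; lia.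
  by rewrite mulzK // mulrC.
apply: (perfect_all (r := fun i a c => cls i a = cls i c)) => i _.
exact: (perfect_comap (cls i) (@perfect_eq_fin _)).
Qed.

End Perfect.

(** * A well-order on the lattice *)

Section LeadingIndex.
Variable d : nat.
Implicit Types (l : seq 'cV[int]_d) (u : 'cV[int]_d) (a b c : 'rV[int]_d).

(** The enumeration 0, -1, 1, -2, 2, ... of the integers: the absolute value,
    with ties broken by the sign. *)
Definition rank (n : int) : nat :=
  match n with Posz k => k.*2 | Negz k => k.*2.+1 end.

Lemma rank_inj : injective rank.
Proof. by case=> m [] n; rewrite /rank; lia. Qed.

(** The increment n' points away from the origin at n, so that no integer of
    smaller rank is moved further than n. *)
Lemma rank_step C n n' n'' : step C.+1 n (n + n') ->
  (rank n'' < rank n)%N -> (rank (n'' + n') < rank (n + n'))%N.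
Proof.
have rankE k : rank k = if 0 <= k then (`|k|%N).*2 else (`|k|%N).*2.-1.
  by case: k => k; rewrite /rank /=; lia.
rewrite !rankE /step; do ![case: ifP]; lia.
Qed.

Fixpoint keylt l a a' : bool :=
  if l is u :: l' then
    (rank (lform u a) < rank (lform u a'))%N ||
    (lform u a == lform u a') && keylt l' a a'
  else false.

Lemma keylt_trans l : transitive (keylt l).
Proof.
elim: l => // u l IHl a a' a'' /=.
move=> /orP[lt1|/andP[/eqP-> lt1]] /orP[lt2|/andP[/eqP<- lt2]].
- by rewrite (ltn_trans lt1 lt2).
- by rewrite lt1.
- by rewrite lt2.
- by rewrite eqxx (IHl _ _ _ lt1 lt2) orbT.
Qed.

Lemma keylt_irr l a : keylt l a a = false.
Proof. by elim: l => //= u l ->; rewrite ltnn andbF. Qed.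

Lemma keylt_total l a a' : ~~ keylt l a a' -> ~~ keylt l a' a ->
  forall u, u \in l -> lform u a = lform u a'.
Proof.
elim: l => // u l IHl /=; rewrite !negb_or -!leqNgt.
move=> /andP[le1 n1] /andP[le2 n2].
have eqa : lform u a = lform u a'.
  by apply: rank_inj; apply/eqP; rewrite eqn_leq le1 le2.
rewrite eqa eqxx /= in n1 n2 => v; rewrite inE => /predU1P[->//|].
exact: IHl.
Qed.

Lemma keylt_add C l a b a'' :
  (forall u, u \in l -> step C.+1 (lform u a) (lform u (a + b))) ->
  keylt l a'' a -> keylt l (a'' + b) (a + b).
Proof.
elim: l => // u l IHl stepl /= /orP[lt|/andP[/eqP eqa lt]].
  rewrite !lformD (rank_step (C := C)) // -lformD; apply: stepl.
  by rewrite inE eqxx.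
rewrite !lformD eqa eqxx IHl ?orbT // => v vl; apply: stepl.
by rewrite inE vl orbT.
Qed.

Lemma keylt_wf l : well_founded (keylt l).
Proof.
elim: l => [|u l IHl]; first by move=> a; constructor.
move=> a; have [n] := ubnP (rank (lform u a)); elim: n a => [a|n IHn a].
  by rewrite ltn0.
elim/(well_founded_ind IHl): a => a IHa lta; constructor => a' /=.
move=> /orP[lt|/andP[/eqP eqa lt]]; first by apply: IHn; apply: leq_trans lt _.
by apply: IHa => //; rewrite eqa.
Qed.

Lemma keylt_max l (s : seq 'rV[int]_d) : s != [::] ->
  exists2 a, a \in s & forall a', a' \in s -> ~~ keylt l a a'.
Proof.
elim: s => // a [|a1 s] IHs _.
  exists a; first by rewrite inE.
  by move=> a'; rewrite inE => /eqP->; rewrite keylt_irr.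
have [//|c cs cmax] := IHs.
have [ca|nca] := boolP (keylt l c a).
  exists a; first by rewrite inE eqxx.
  move=> a'; rewrite inE => /predU1P[->|/cmax]; first by rewrite keylt_irr.
  by apply: contra => /(keylt_trans ca).
exists c; first by rewrite inE cs orbT.
by move=> a'; rewrite inE => /predU1P[->|/cmax].
Qed.

End LeadingIndex.

(** * Homogeneous components of differential operators *)

Section Operators.
Variables (K : fieldType) (d : nat).
Local Notation Zd := 'rV[int]_d.
Local Notation E := (endo (laurent K d)).

(** The coefficient f_a of P = sum_a t^a f_a(s), as a function on the lattice. *)
Definition opcoef (P : E) (a x : Zd) : K := (P (mkmalgU x 1))@_(x + a).

Lemma opcoefB P Q a x : opcoef (P - Q) a x = opcoef P a x - opcoef Q a x.
Proof. exact: mcoeffB. Qed.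

Lemma opcoefD P Q a x : opcoef (P + Q) a x = opcoef P a x + opcoef Q a x.
Proof. exact: mcoeffD. Qed.

Lemma opcoef_monop c e a x : opcoef (monop c e) a x = (c x) *+ (a == e).
Proof.
rewrite /opcoef /= mcoeff_monop mcoeffU.
have -> : (x == x + a - e) = (a == e).
  by rewrite -addrA -subr_eq0 opprD addrA subrr sub0r oppr_eq0 subr_eq0.
by rewrite mulr_natr; case: eqVneq => [->|_]; rewrite ?addrK.
Qed.

Lemma opcoef_monopM c e P a x :
  opcoef (monop c e * P) a x = c (x + (a - e)) * opcoef P (a - e) x.
Proof. by rewrite /opcoef addrA -mcoeff_monop. Qed.

Lemma malgU_scale (x : Zd) (g : K) :
  mkmalgU x g = g *: mkmalgU x 1 :> {malg K[Zd]}.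
Proof.
apply/malgP => z; rewrite mcoeffZ; apply: (etrans (mcoeffU x g z)).
rewrite -mulr_natr; congr (_ * _); apply: esym; exact: (mcoeffU x 1 z).
Qed.

Lemma endo_expand (P : E) (f : laurent K d) (D : {fset Zd}) y :
  (msupp f `<=` D)%fset -> (P f)@_y = \sum_(x <- D) f@_x * opcoef P (y - x) x.
Proof.
move=> /monalgEw fE; rewrite {1}fE raddf_sum raddf_sum; apply: eq_bigr => x _.
rewrite /opcoef subrKC -mcoeffZ -linearZ; congr ((P _)@_y).
exact: malgU_scale.
Qed.

Lemma opcoefM (P Q : E) (D : {fset Zd}) a x :
  (forall c y, c \notin D -> opcoef Q c y = 0) ->
  opcoef (P * Q) a x =
  \sum_(c <- D) opcoef Q c x * opcoef P (a - c) (x + c).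
Proof.
move=> QD.
rewrite {1}/opcoef (@endo_expand P _ [fset (x + c)%R | c in D]%fset) /=; last first.
  apply/fsubsetP => y; rewrite -mcoeff_neq0 => yQ; apply/imfsetP => /=.
  exists (y - x); last by rewrite subrKC.
  apply: contraNT yQ => /(QD _ x) /eqP.
  by rewrite /opcoef subrKC.
rewrite big_imfset /=; last by move=> y z _ _; exact: addrI.
by apply: eq_bigr => c _; rewrite opprD addrACA subrr add0r.
Qed.

Lemma opcoef_eq (P Q : E) : (forall a x, opcoef P a x = opcoef Q a x) -> P = Q.
Proof.
move=> PQ; apply: endoP => f; apply/malgP => y.
rewrite !(endo_expand _ _ (fsubset_refl _)).
by apply: eq_bigr => x _; rewrite PQ.
Qed.

Lemma monop_ext c c' e : c =1 c' -> monop c e = monop c' e :> E.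
Proof. by move=> /funext->. Qed.

Lemma monopM c e c' e' :
  monop c e * monop c' e' = monop (fun x => c (x + e') * c' x) (e + e') :> E.
Proof.
apply: opcoef_eq => a x; rewrite opcoef_monopM !opcoef_monop.
have -> : (a - e == e') = (a == e + e') by rewrite subr_eq addrC.
case: eqVneq => [->|_]; last by rewrite mulr0.
by rewrite addrAC subrr add0r.
Qed.

Lemma monopD c c' e : monop c e + monop c' e = monop (fun x => c x + c' x) e :> E.
Proof.
apply: opcoef_eq => a x; rewrite opcoefD !opcoef_monop.
by case: eqP; rewrite ?addr0.
Qed.

Lemma endo_scalar_monop k : endo_scalar (laurent K d) k = monop (fun=> k) 0.
Proof.
by apply: endoP => f; apply/malgP => y; rewrite /= mcoeffZ mcoeff_monop subr0.
Qed.

Definition is_diffop (P : E) : Prop :=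
  (forall a, polyfun (opcoef P a)) /\
  exists D : {fset Zd}, forall a x, a \notin D -> opcoef P a x = 0.

Lemma is_diffop_monop c e : polyfun c -> is_diffop (monop c e).
Proof.
move=> pc; split=> [a|].
  have [->|ae] := eqVneq a e.
    have -> // : opcoef (monop c e) e = c.
    by apply/funext => x; rewrite opcoef_monop eqxx.
  have -> : opcoef (monop c e) a = fun=> 0.
    by apply/funext => x; rewrite opcoef_monop (negPf ae).
  exact: polyfunC.
by exists [fset e]%fset => a x; rewrite inE opcoef_monop => /negPf->.
Qed.

(** The operators with polynomial coefficients and finitely many degrees form a
    ring, by the product formula opcoefM, and it contains the generators. *)
Lemma DZ_is_diffop (P : E) : DZ P -> is_diffop P.
Proof.
apply; split.
  split.
  - apply: mem_set; have -> : 1 = monop (fun=> 1) 0 :> E.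
      by rewrite -endo_scalar_monop; apply: endoP => f /=; rewrite scale1r.
    exact/is_diffop_monop/polyfunC.
  - move=> P1 P2 /set_mem[p1 [D1 d1]] /set_mem[p2 [D2 d2]]; apply: mem_set.
    split=> [a|].
      have -> : opcoef (P1 - P2) a = fun x => opcoef P1 a x - opcoef P2 a x.
        by apply/funext => x; rewrite opcoefB.
      exact: polyfunB.
    exists (D1 `|` D2)%fset => a x; rewrite inE negb_or opcoefB.
    by move=> /andP[/d1-> /d2->]; rewrite subrr.
  - move=> P1 P2 /set_mem[p1 [D1 d1]] /set_mem[p2 [D2 d2]]; apply: mem_set.
    have d2' c y : c \notin D2 -> opcoef P2 c y = 0 by exact: d2.
    split=> [a|].
      have -> : opcoef (P1 * P2) a = fun x =>
          \sum_(c <- D2) opcoef P2 c x * opcoef P1 (a - c) (x + c).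
        by apply/funext => x; rewrite (opcoefM P1 a x d2').
      apply: polyfun_sum => c; apply: polyfunM => //.
      exact: (polyfun_shift c (p1 (a - c))).
    exists [fset (c1 + c2)%R | c1 in D1, c2 in D2]%fset => a x aD.
    rewrite (opcoefM P1 a x d2') big_seq big1 // => c cD2; rewrite d1 ?mulr0 //.
    apply: contra aD => acD1; apply/imfset2P; exists (a - c) => //.
    by exists c => //; rewrite subrK.
move=> _ [[[[k _ <-]|[i _ <-]]|[i _ <-]]|[i _ <-]].
- by rewrite endo_scalar_monop; exact/is_diffop_monop/polyfunC.
- exact/is_diffop_monop/polyfunC.
- exact/is_diffop_monop/polyfunC.
- exact/is_diffop_monop/polyfunX.
Qed.

Lemma DZ_gen (P : E) : DZ_generators P -> DZ P.
Proof. by move=> gP H [_]; apply. Qed.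

Lemma DZD (P Q : E) : DZ P -> DZ Q -> DZ (P + Q).
Proof.
move=> DP DQ H HE; have [[H1 Hsub _] _] := HE.
have H0 : 0 \in [pred P | P \in H] by rewrite -(subrr 1); apply: Hsub.
apply: set_mem; rewrite -[Q]opprK; apply: (Hsub); first by apply: mem_set; apply: DP.
by rewrite -sub0r; apply: Hsub => //; apply: mem_set; apply: DQ.
Qed.

Lemma DZM (P Q : E) : DZ P -> DZ Q -> DZ (P * Q).
Proof.
move=> DP DQ H HE; have [[_ _ HM] _] := HE; apply: set_mem.
by apply: HM; apply: mem_set; [apply: DP|apply: DQ].
Qed.

Lemma DZ_monop0 c : polyfun c -> DZ (monop c 0 : E).
Proof.
elim=> [k|i|f g _ Df _ Dg|f g _ Df _ Dg].
- by rewrite -endo_scalar_monop; apply: DZ_gen; left; left; left; exists k.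
- have -> : monop (fun x : Zd => (x 0 i)%:~R) 0 =
      laurent_mulX K i * laurent_deriv K i.
    by rewrite monopM subrr; apply: monop_ext => x; rewrite mul1r.
  by apply: DZM; apply: DZ_gen; [left; left; right|right]; exists i.
- by rewrite -monopD; apply: DZD.
- have -> : monop (fun x : Zd => f x * g x) 0 = monop f 0 * monop g 0 :> E.
    by rewrite monopM addr0; apply: monop_ext => x; rewrite addr0.
  exact: DZM.
Qed.

Lemma DZ_monop1 e : DZ (monop (fun=> 1) e : E).
Proof.
have add e1 e2 : DZ (monop (fun=> 1) e1 : E) -> DZ (monop (fun=> 1) e2 : E) ->
    DZ (monop (fun=> 1) (e1 + e2) : E).
  move=> D1 D2; have -> : monop (fun=> 1) (e1 + e2) =
      monop (fun=> 1) e1 * monop (fun=> 1) e2 :> E.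
    by rewrite monopM; apply: monop_ext => x; rewrite mulr1.
  exact: DZM.
have mul e1 n : DZ (monop (fun=> 1) e1 : E) -> DZ (monop (fun=> 1) (e1 *+ n) : E).
  move=> D1; elim: n => [|n IHn]; last by rewrite mulrS; apply: add.
  by rewrite mulr0n; apply: DZ_monop0; exact: polyfunC.
rewrite (row_sum_delta e).
apply: (big_ind (fun e => DZ (monop (fun=> 1) e : E))) => [||i _].
- by apply: DZ_monop0; exact: polyfunC.
- exact: add.
- rewrite -[e 0 i]intz scaler_int; case: (e 0 i) => n.
    by rewrite -pmulrn; apply: mul; apply: DZ_gen; left; left; right; exists i.
  rewrite NegzE mulrNz -mulNrz -pmulrn.
  by apply: mul; apply: DZ_gen; left; right; exists i.
Qed.

(** t^e f(s) is the product of a Laurent monomial and of a polynomial in the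
    Euler operators s_i = t_i d/dt_i. *)
Lemma DZ_monop c e : polyfun c -> DZ (monop c e : E).
Proof.
move=> pc; have -> : monop c e = monop (fun=> 1) e * monop c 0 :> E.
  by rewrite monopM addr0; apply: monop_ext => x; rewrite mul1r.
by apply: DZM; [exact: DZ_monop1|exact: DZ_monop0].
Qed.

Lemma Dpred_opcoef (T : set Zd) (P : E) a x :
  P \in Dpred T -> T x -> ~ T (x + a) -> opcoef P a x = 0.
Proof.
move=> /asboolP[_ PT] Tx nTxa; apply/eqP; apply: contra_notT nTxa => nz.
apply: (PT (P (mkmalgU x 1))); last by rewrite -mcoeff_neq0.
exists (mkmalgU x 1) => // y; rewrite -mcoeff_neq0 mcoeffU.
by case: (x =P y) => [<-//|_]; rewrite mulr0n eqxx.
Qed.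

Lemma Dpred_monop (T : set Zd) c e : polyfun c ->
  (forall x, T x -> ~ T (x + e) -> c x = 0) -> (monop c e : E) \in Dpred T.
Proof.
move=> pc c0; apply/asboolP; split; first exact: DZ_monop.
move=> _ [f Tf <-] y; rewrite -mcoeff_neq0 /= mcoeff_monop => nz.
apply: contrapT => nTy; case/eqP: nz; have [f0|f0] := eqVneq (f@_(y - e)) 0.
  by rewrite f0 mulr0.
rewrite c0 ?mul0r ?subrK //; apply: Tf; rewrite -mcoeff_neq0 //.
Qed.

End Operators.

(** * Operators preserving a set cut out by level conditions *)

Lemma uniform_bound (X : eqType) (L : seq X) (Q : X -> nat -> Prop) :
  (forall x, x \in L -> exists N, forall n, (N <= n)%N -> Q x n) ->
  exists N, forall x, x \in L -> forall n, (N <= n)%N -> Q x n.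
Proof.
elim: L => [|x L IHL] LQ; first by exists 0%N.
have [N xN] := LQ x (mem_head _ _).
have [|N' LN'] := IHL; first by move=> y yL; apply: LQ; rewrite inE yL orbT.
exists (maxn N N') => y; rewrite inE => yxL n; rewrite geq_max => /andP[Nn N'n].
by case/predU1P: yxL => [->|yL]; [exact: xN|exact: LN'].
Qed.

Lemma finite_int_bound (X : set int) :
  finite_set X -> exists N, forall n, X n -> (`|n| <= N)%N.
Proof.
move=> finX.
have [|N NP] := @uniform_bound _ (fset_set X) (fun n N => (`|n| <= N)%N).
  by move=> n _; exists `|n|%N.
by exists N => n Xn; apply: NP => //; rewrite in_fset_set //; exact/mem_set.
Qed.

Section Escape.
Variable M : set int.
Hypothesis finM : forall n, finite_set [set m | M m /\ ~ M (m + n)].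

Definition escape (n : int) : {fset int} := fset_set [set m | M m /\ ~ M (m + n)].

Lemma escapeP n m : reflect (M m /\ ~ M (m + n)) (m \in escape n).
Proof.
rewrite in_fset_set //; apply: (iffP idP); [exact: set_mem|exact: mem_set].
Qed.

Variable C : nat.
Hypothesis upM : forall n, C%:Z <= n -> forall m, M m -> M (m + n).

Lemma escape_ge n : C%:Z <= n -> escape n = fset0.
Proof.
move=> Cn; apply/fsetP => m; rewrite in_fset0; apply/negbTE/escapeP.
by move=> [/(upM Cn)].
Qed.

Lemma escape0 : escape 0 = fset0.
Proof.
by apply/fsetP => m; rewrite in_fset0; apply/negbTE/escapeP; rewrite addr0 => -[].
Qed.

(** A level escaping under n + n' escapes under n, or else its translate by n
    escapes under n'. The converse uses that long steps neither leave M and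
    enter it again nor the contrary. *)
Lemma escape_prod_step (R : comPzRingType) (F : int -> R) n n' :
  step C n (n + n') ->
  (\prod_(m <- escape n') F (m - n)) * \prod_(m <- escape n) F m =
  \prod_(m <- escape (n + n')) F m.
Proof.
move=> [|[[Cn Cn']|[nC n'C]]].
- rewrite -{2}[n]addr0 => /addrI ->.
  by rewrite escape0 big_seq_fset0 mul1r addr0.
- rewrite (addrC n) addrK in Cn'.
  by rewrite !escape_ge ?big_seq_fset0 ?mul1r //; lia.
rewrite (addrC n) addrK in n'C.
rewrite -(big_map (fun m => m - n) xpredT) -big_cat; apply: perm_big.
have up k m : k <= - C%:Z -> M (m + k) -> M m.
  by move=> kC Mmk; rewrite -(addrK k m); apply: upM => //; lia.
apply: uniq_perm; last 1 first.
- move=> m; rewrite mem_cat; apply/orP/idP => [[/mapP[m' /escapeP[Mm' nMm'] ->]|]|].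
  + apply/escapeP; split.
      by apply: (up n) => //; rewrite subrK.
    by rewrite addrA subrK.
  + move=> /escapeP[Mm nMm]; apply/escapeP; split=> //.
    by rewrite addrA => /(up n' _ n'C).
  + move=> /escapeP[Mm nMm]; have [Mmn|nMmn] := pselect (M (m + n)).
      left; apply/mapP; exists (m + n); last by rewrite addrK.
      by apply/escapeP; rewrite -addrA.
    by right; apply/escapeP.
- rewrite cat_uniq map_inj_uniq ?fset_uniq ?andbT /=; last exact: addIr.
  apply/hasPn => m /escapeP[_ nMmn]; apply/mapP => -[m' /escapeP[Mm' _] mE].
  by apply: nMmn; rewrite mE subrK.
- exact: fset_uniq.
Qed.

End Escape.

Section LevelSets.
Variables (K : fieldType) (d : nat).
Hypothesis K0 : [pchar K] =i pred0.
Local Notation Zd := 'rV[int]_d.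
(* An exit of a is a point x of S with x + a outside S. By S_dense the exits
   across a level in M are dense in it. By S_exit, if a is a multiple of a fixed
   integer, all other exits lie at levels in G for forms that are nonzero at a. *)
Variables (U : seq 'cV[int]_d) (M G : 'cV[int]_d -> set int) (S : set Zd).
Hypotheses (U_uniq : uniq U)
  (U_surj : forall u, u \in U -> exists e, lform u e = 1)
  (U_indep : forall u v, u \in U -> v \in U -> u != v ->
     exists2 y, lform v y = 0 & lform u y != 0)
  (M_up : exists C : nat, forall u, u \in U ->
     forall n, C%:Z <= n -> forall m, M u m -> M u (m + n))
  (M_fin : forall u, u \in U -> forall n, finite_set [set m | M u m /\ ~ M u (m + n)])
  (G_fin : forall u, u \in U -> finite_set (G u))
  (S_dense : forall u m a, u \in U -> M u m -> ~ M u (m + lform u a) ->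
     exists x (B : {fset Zd}), [/\ lform u x = m,
       forall y, NN B y -> S (x + y) /\ ~ S (x + y + a)
     & forall y, lform u y = 0 -> exists2 k, (0 < k)%N & ZZ B (y *+ k)])
  (S_exit : exists C : nat, forall x y, S x -> ~ S (x + y *+ C.+1) ->
     exists2 u, u \in U &
       (M u (lform u x) /\ ~ M u (lform u (x + y *+ C.+1))) \/
       (G u (lform u x) /\ lform u (y *+ C.+1) != 0)).

(** The polynomial r_a: it vanishes on the hyperplanes that are left by the
    translation by a. *)
Definition divisor (a x : Zd) : K :=
  \prod_(u <- U) \prod_(m <- escape (M u) (lform u a)) (lform u x - m)%:~R.

Lemma polyfun_divisor a : polyfun (divisor a).
Proof.
apply: polyfun_prod => u; apply: polyfun_prod => m; exact: polyfun_lform.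
Qed.

(** The exits of a are dense in each of these hyperplanes by S_dense. *)
Lemma divisor_dvd a f : polyfun f -> (forall x, S x -> ~ S (x + a) -> f x = 0) ->
  exists2 g, polyfun g & forall x, f x = divisor a x * g x.
Proof.
move=> pf f0.
pose L := [seq (u, m) | u <- U, m <- enum_fset (escape (M u) (lform u a))].
have LP p : p \in L -> p.1 \in U /\ (M p.1 p.2 /\ ~ M p.1 (p.2 + lform p.1 a)).
  move=> /allpairsPdep[u [m [uU mP ->]]]; split=> //=.
  by apply/escapeP => //; exact: M_fin.
have L_uniq : uniq L.
  apply: allpairs_uniq_dep => [//|u _|]; first exact: fset_uniq.
  by move=> [u m] [v n] _ _ /= [-> ->].
have f_van p x : p \in L -> lform p.1 x = p.2 -> f x = 0.
  move=> /LP[pU [Mp nMp]].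
  have [x0 [B [x0p BS Bp]]] := S_dense pU Mp nMp.
  apply: (polyfun_vanish_hyperplane K0 pf x0p Bp) => y By.
  by have [] := BS y By; exact: f0.
have [g pg fE] := polyfun_prod_dvd K0 L_uniq
  (fun p pL => U_surj (LP p pL).1)
  (fun p q pL qL => U_indep (LP p pL).1 (LP q qL).1) pf f_van.
exists g => // x; rewrite fE big_allpairs_dep; congr (_ * _).
Qed.

(** The coordinates are added to the normals so that the forms separate points. *)
Definition key_forms : seq 'cV[int]_d := U ++ [seq delta_mx i 0 | i <- enum 'I_d].

Lemma key_forms_sep x y :
  (forall u, u \in key_forms -> lform u x = lform u y) -> x = y.
Proof.
move=> xy; apply/rowP => i.
have := xy (delta_mx i 0); rewrite /lform -!colE !mxE; apply.
by rewrite mem_cat; apply/orP; right; apply: map_f; rewrite mem_enum.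
Qed.

(** The factors of r_b(x + a) r_a(x) and of r_(a+b)(x) agree facet by facet. *)
Lemma divisor_step C a b x :
  (forall u, u \in U -> forall n, C%:Z <= n -> forall m, M u m -> M u (m + n)) ->
  (forall u, u \in U -> step C (lform u a) (lform u (a + b))) ->
  divisor b (x + a) * divisor a x = divisor (a + b) x.
Proof.
move=> upM stepU; rewrite /divisor -big_split /=.
apply: eq_big_seq => u uU; rewrite !lformD.
rewrite -(escape_prod_step (M_fin uU) (upM u uU) (fun m => (lform u x - m)%:~R)).
  congr (_ * _); apply: eq_bigr => m _; congr (_%:~R); ring.
by rewrite -lformD; apply: stepU.
Qed.

Local Notation T := (polyring K d).
Local Notation keylt := (keylt key_forms).

(** Left multiplication by t^(c - a) f(s) turns a leading term t^a r_a g into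
    the leading term t^c r_c h g. *)
Definition transition (a c : Zd) : set T :=
  [set h | (forall a', keylt a' a -> keylt (a' + (c - a)) c) /\
    exists2 f, polyfun f & (forall x, S x -> ~ S (x + (c - a)) -> f x = 0) /\
      forall x, f (x + a) * divisor a x = divisor c x * (h : T) x].

Definition leading (X : set (Dring K S)) (a : Zd) : set T :=
  [set g | exists2 P : Dring K S, X P &
    (forall x, opcoef P a x = divisor a x * (g : T) x) /\
    forall c, keylt a c -> forall x, opcoef P c x = 0].

(** The ideals absorb K[s] because the operators f(s) of degree zero preserve
    every set, and absorb transitions by construction. *)
Lemma leading_system X : left_ideal X -> system transition (leading X).
Proof.
move=> [X0 XD XM].
have lt_shift a b c : (forall a', keylt a' a -> keylt (a' + b) (a + b)) ->
    keylt (a + b) c -> keylt a (c - b).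
  move=> mono abc; apply: contraT => nlt.
  have [lt|nlt'] := boolP (keylt (c - b) a).
    by have := mono _ lt; rewrite subrK => /(keylt_trans abc); rewrite keylt_irr.
  have acb := key_forms_sep (keylt_total nlt nlt').
  by move: abc; rewrite acb subrK keylt_irr.
split=> [a|a c h g [mono [f pf [f0 fE]]] [P XP [Pa Pgt]]].
- split.
  + exists 0 => //; split=> [x|c _ x]; last exact: mcoeff0.
    by rewrite mulr0; exact: mcoeff0.
  + move=> g g' [P XP [Pa Pgt]] [P' XP' [P'a P'gt]].
    exists (P + P'); first exact: XD.
    split=> [x|c ac x]; rewrite opcoefD.
      by rewrite Pa P'a -mulrDr.
    by rewrite Pgt // P'gt // addr0.
  + move=> h g [P XP [Pa Pgt]].
    have ph := polyfun_shift (- a) (pvalP h).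
    have hD : (monop (fun x => h (x - a)) 0 : endo (laurent K d)) \in Dpred S.
      by apply: Dpred_monop => // x Sx; rewrite addr0.
    exists (DOp hD * P); first exact: XM.
    split=> [x|c ac x]; rewrite [LHS]opcoef_monopM subr0.
      by rewrite addrK Pa mulrCA.
    by rewrite Pgt // mulr0.
- have fD : (monop f (c - a) : endo (laurent K d)) \in Dpred S.
    by apply: Dpred_monop.
  exists (DOp fD * P); first exact: XM.
  split=> [x|c' cc' x]; rewrite [LHS]opcoef_monopM.
    by rewrite subKr Pa mulrA fE mulrA.
  rewrite Pgt ?mulr0 //; apply: lt_shift => [a'|]; first by rewrite subrKC; exact: mono.
  by rewrite subrKC.
Qed.

Lemma leading_index (P : Dring K S) : (forall a x, opcoef P a x = 0) \/
  exists2 a, exists x, opcoef P a x != 0 &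
    forall c, keylt a c -> forall x, opcoef P c x = 0.
Proof.
have [DP _] := asboolP _ (Dval_in P); have [_ [D PD]] := DZ_is_diffop DP.
pose supp := [seq a <- enum_fset D | `[< exists x, opcoef P a x != 0 >]].
have suppP a x : opcoef P a x != 0 -> a \in supp.
  move=> nz; rewrite mem_filter; apply/andP; split; first by apply/asboolP; exists x.
  by apply: contraNT nz => aD; rewrite PD.
have [supp0|supp0] := eqVneq supp [::].
  by left=> a x; apply: contraTeq isT => /suppP; rewrite supp0.
right; have [a] := keylt_max key_forms supp0.
rewrite mem_filter => /andP[/asboolP nza _] amax; exists a => // c ac x.
by apply: contraTeq ac => /suppP; exact: amax.
Qed.

(** Subtracting from an element of Y an element of X with the same leading term
    lowers the leading index, and the order on indices is well-founded. *)
Lemma leading_inj X Y : left_ideal X -> left_ideal Y -> X `<=` Y ->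
  (forall a, leading Y a `<=` leading X a) -> Y `<=` X.
Proof.
move=> [X0 XD XM] [_ YD YM] XY leadYX.
have X_eq0 (P : Dring K S) : (forall a x, opcoef P a x = 0) -> X P.
  move=> P0; suff -> : P = 0 by [].
  by apply/val_inj/opcoef_eq => a x; rewrite P0; exact/esym/mcoeff0.
suff H a (P : Dring K S) : Y P ->
    (forall c, keylt a c -> forall x, opcoef P c x = 0) -> X P.
  move=> P YP; have [/X_eq0//|[a _]] := leading_index P; exact: H.
elim/(well_founded_ind (@keylt_wf _ key_forms)): a P => a IHa P YP Pa.
have [DP _] := asboolP _ (Dval_in P); have [pP _] := DZ_is_diffop DP.
have [g pg gE] := divisor_dvd (pP a) (fun x => Dpred_opcoef (Dval_in P)).
have [P' XP' [P'a P'gt]] : leading X a (to_polyring pg).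
  by apply: leadYX; exists P.
suff XQ : X (P - P') by rewrite -(subrK P' P); apply: XD.
have Qge c : c = a \/ keylt a c -> forall x, opcoef (P - P' : Dring K S) c x = 0.
  move=> ac x; rewrite [LHS]opcoefB; case: ac => [->|ac].
    by rewrite P'a gE subrr.
  by rewrite Pa // P'gt // subr0.
have [/X_eq0//|[a' [x nz] Qa']] := leading_index (P - P').
apply: (IHa a') => //; last by rewrite -mulN1r; apply: YD => //; exact/YM/XY.
apply: contraNT nz => nlt; rewrite Qge //.
have [|nlt'] := boolP (keylt a a'); first by right.
by left; apply/key_forms_sep/keylt_total.
Qed.

Definition level_poly (u : 'cV[int]_d) (m : int) : T :=
  to_polyring (polyfun_lform K u m).

(** For each u at most one integer k has u - k in P, since the difference of two
    of them would be a unit in P. The value of u at a is then m - k, where m is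
    one of finitely many gaps. *)
Lemma prime_level_bound (P : set T) : prime_ideal P ->
  exists C : nat, forall u, u \in U -> forall m a, G u m ->
    P (level_poly u (m - lform u a)) -> (`|lform u a| < C)%N.
Proof.
move=> [[_ PD PM] P1 _].
have level_inj u k k' : P (level_poly u k) -> P (level_poly u k') -> k = k'.
  move=> Pk Pk'; apply: contrapT => /eqP; rewrite -subr_eq0 => kk'.
  have kk'K : (k - k')%:~R != 0 :> K.
    by apply: contra kk' => /eqP; rewrite -(rmorph0 intr) => /(intr_inj_pchar0 K0)->.
  apply: P1; have -> : 1 = polyring_const d (k - k')%:~R^-1 *
      (level_poly u k' + (-1) * level_poly u k) :> T.
    apply: polyring_eq => x; apply/esym.
    have -> : pval (polyring_const d (k - k')%:~R^-1 *
      (level_poly u k' + (-1) * level_poly u k)) x = (k - k')%:~R^-1 *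
      ((lform u x - k')%:~R + (-1) * (lform u x - k)%:~R) by [].
    have -> : (lform u x - k')%:~R + -1 * (lform u x - k)%:~R = (k - k')%:~R :> K.
      by rewrite mulN1r -rmorphN -rmorphD; congr (_%:~R); ring.
    by rewrite mulVf.
  by apply/PM/PD => //; apply: PM.
suff [C CP] : exists C, forall u, u \in U -> forall n, (C <= n)%N ->
    forall m a, G u m -> P (level_poly u (m - lform u a)) ->
      (`|lform u a| < n)%N.
  by exists C => u uU; exact: CP.
apply: uniform_bound.
move=> u uU; have [N GN] := finite_int_bound (G_fin uU).
have [[k Pk]|nok] := pselect (exists k, P (level_poly u k)); last first.
  by exists 0%N => n _ m a _ Pm; case: nok; exists (m - lform u a).
exists (N + `|k|%N).+1 => n Nn m a /GN mN /(level_inj _ _ _ Pk) kE; lia.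
Qed.

(** The transition to c uses the operator t^(c - a) r_(c - a) w, where w collects
    the factors lform u - m, m in G u, whose translates by a are outside P. It
    preserves S: an exit at which r_(c - a) is nonzero lies by S_exit on some
    hyperplane lform u = m, m in G u, with lform u (c - a) nonzero. The
    translate by a of that factor is outside P, for otherwise lform u a would
    be small and c, being related to a, would have the same value. So w vanishes
    at this exit. *)
Lemma transition_prime (P : set T) : prime_ideal P ->
  exists2 r : Zd -> Zd -> Prop, good_pairs r &
    forall a, exists2 q, ~ P q & forall c, r a c -> transition a c q.
Proof.
move=> P_prime; have [C1 C1P] := prime_level_bound P_prime.
have [C2 C2P] := M_up; have [C0 C0P] := S_exit.
pose C := maxn C1 C2.
exists (fun a c => (forall u, u \in key_forms -> step C.+1 (lform u a) (lform u c)) /\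
    exists y, c - a = y *+ C0.+1).
  apply/perfect_good_pairs/perfect_and; last exact: perfect_congr.
  apply: (perfect_all (r := fun u a c => step C.+1 (lform u a) (lform u c))).
  by move=> u _; apply: (perfect_comap (lform u)); exact: perfect_step.
move=> a.
pose bad u m := `[< P (level_poly u (m - lform u a)) >].
pose q : T := \prod_(u <- U)
  \prod_(m <- [seq m <- enum_fset (fset_set (G u)) | ~~ bad u m])
    level_poly u (m - lform u a).
have qE x : q x = \prod_(u <- U)
    \prod_(m <- [seq m <- enum_fset (fset_set (G u)) | ~~ bad u m])
      (lform u (x + a) - m)%:~R.
  have prodE (J : Type) (s : seq J) (F : J -> T) : (\prod_(j <- s) F j) x =
      \prod_(j <- s) (F j) x.
    by elim: s => [|j s IHs]; rewrite ?big_nil // !big_cons -IHs.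
  rewrite /q prodE; apply: eq_bigr => u _; rewrite prodE; apply: eq_bigr => m _.
  by rewrite lformD /= opprB addrA.
have [_ P1 PM] := P_prime; exists q.
  have prodP (J : eqType) (s : seq J) (F : J -> T) :
      (forall j, j \in s -> ~ P (F j)) -> ~ P (\prod_(j <- s) F j).
    move=> nPF; rewrite big_seq; elim/big_ind: _ => // x y nPx nPy.
    by case/PM.
  apply: (prodP) => u _; apply: prodP => m.
  by rewrite mem_filter => /andP[/asboolP].
move=> c [stepC [y cay]].
have cE : c = a + (c - a) by rewrite subrKC.
split=> [a' lt|]; first by rewrite [in X in keylt _ X]cE; apply: keylt_add lt;
  move=> u uU; rewrite -cE; exact: stepC.
pose w x : K := \prod_(u <- U)
  \prod_(m <- [seq m <- enum_fset (fset_set (G u)) | ~~ bad u m])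
    (lform u x - m)%:~R.
exists (fun x => divisor (c - a) x * w x).
  apply: polyfunM; first exact: polyfun_divisor.
  by apply: polyfun_prod => u; apply: polyfun_prod => m; exact: polyfun_lform.
have prod0 (J : eqType) (s : seq J) (F : J -> K) j :
    j \in s -> F j = 0 -> \prod_(j <- s) F j = 0.
  by move=> js Fj; rewrite (big_rem j) //= Fj mul0r.
split=> x.
  move=> Sx nSx; rewrite cay in nSx.
  have [u uU [[Mx nMx]|[Gx ny]]] := C0P x y Sx nSx.
    rewrite /divisor (prod0 _ _ _ u) ?mul0r //.
    apply: (prod0 _ _ _ (lform u x)); last by rewrite subrr.
    by apply/escapeP; [exact: M_fin|rewrite cay -lformD].
  rewrite /w mulrC (prod0 _ _ _ u) ?mul0r //.
  apply: (prod0 _ _ _ (lform u x)); last by rewrite subrr.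
  rewrite mem_filter in_fset_set; last exact: G_fin.
  rewrite (mem_set Gx) andbT; apply/asboolP => /(C1P u uU _ _ Gx) lt.
  have uk : u \in key_forms by rewrite mem_cat uU.
  case: (stepC u uk) => [eqc|].
    by move: ny; rewrite -cay lformB eqc subrr eqxx.
  by rewrite /C; lia.
rewrite qE -/(w (x + a)) mulrAC; congr (_ * _).
rewrite [X in _ = divisor X x]cE; apply: (@divisor_step C.+1) => u uU; last first.
  by rewrite -cE; apply: stepC; rewrite mem_cat uU.
by move=> n Cn; apply: C2P => //; move: Cn; rewrite /C; lia.
Qed.

Theorem level_set_noetherian : left_noetherian (Dring K S).
Proof.
apply: acc_left_noetherian => J J_ideal J_S.
have leading_S n a : leading (J n) a `<=` leading (J n.+1) a.
  by move=> g [P JP Pg]; exists P => //; exact: J_S.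
have [n0 n0P] := acc_systems (acc_ideals_polyring (K := K) (d := d))
  transition_prime (fun n => leading_system (J_ideal n)) leading_S.
exists n0 => n n0n; apply: leading_inj => //; first exact: chain_le J_S _ _ n0n.
exact: n0P.
Qed.

End LevelSets.

(** * Rational linear algebra *)

Section RowSpan.
Variables (F : fieldType) (d : nat).

Definition rowspan n (N : 'M[F]_(n, d)) : {vspace 'rV[F]_d} :=
  <<[seq row i N | i <- enum 'I_n]>>%VS.

Lemma rowspanP n (N : 'M[F]_(n, d)) x : (x \in rowspan N) = (x <= N)%MS.
Proof.
apply/idP/idP.
  have -> : rowspan N = <<[tuple row i N | i < n]>>%VS by [].
  move=> /coord_span->; apply: summx_sub => i _; apply: scalemx_sub.
  by rewrite -tnth_nth tnth_mktuple row_sub.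
move=> /submxP[D ->]; rewrite mulmx_sum_row; apply: memv_suml => i _.
by apply/memvZ/memv_span/map_f; rewrite mem_enum.
Qed.

(** The rows of row_base N form a basis of this space. *)
Lemma rowspan_dim n (N : 'M[F]_(n, d)) : \dim (rowspan N) = \rank N.
Proof.
have -> : rowspan N = rowspan (row_base N).
  by apply/vspaceP => x; rewrite !rowspanP eq_row_base.
pose X := [tuple row i (row_base N) | i < \rank N].
have -> : rowspan (row_base N) = <<X>>%VS by [].
suff : free X by rewrite /free => /eqP->; rewrite size_tuple.
apply/freeP => k k0 i.
have : (\row_i k i) *m row_base N = 0.
  rewrite mulmx_sum_row -[RHS]k0; apply: eq_bigr => j _.
  by rewrite -tnth_nth tnth_mktuple mxE.
rewrite -[RHS](mul0mx _ (row_base N)) => /(row_free_inj (row_base_free N)).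
by move=> /rowP/(_ i); rewrite !mxE.
Qed.

Definition gen_mx (B : {fset 'rV[int]_d}) : 'M[F]_(size (enum_fset B), d) :=
  \matrix_i emb F (nth 0 (enum_fset B) i).

Lemma row_gen_mx B a : a \in B -> exists i, row i (gen_mx B) = emb F a.
Proof.
move=> aB; have lt : (index a (enum_fset B) < size (enum_fset B))%N.
  by rewrite index_mem.
by exists (Ordinal lt); rewrite rowK /= nth_index.
Qed.

Lemma fspan_rowspan B : fspan F B = rowspan (gen_mx B).
Proof.
apply: eq_span => x; apply/mapP/mapP => [[a aB ->]|[i _ ->]].
  by have [i <-] := row_gen_mx aB; exists i; rewrite ?mem_enum.
by exists (nth 0 (enum_fset B) i); rewrite ?rowK // mem_nth.
Qed.

Lemma fspanP B x : (x \in fspan F B) = (x <= gen_mx B)%MS.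
Proof. by rewrite fspan_rowspan rowspanP. Qed.

Lemma fspan_dim B : \dim (fspan F B) = \rank (gen_mx B).
Proof. by rewrite fspan_rowspan rowspan_dim. Qed.

Lemma gen_mx_mul0 B (u : 'cV[F]_d) :
  reflect (forall a, a \in B -> emb F a *m u = 0) (gen_mx B *m u == 0).
Proof.
apply: (iffP eqP) => [Bu a aB|Bu].
  by have [i <-] := row_gen_mx aB; rewrite -row_mul Bu row0.
by apply/row_matrixP => i; rewrite row_mul rowK row0 Bu // mem_nth.
Qed.

Lemma gen_mx_sub B n (N : 'M[F]_(n, d)) :
  (forall a, a \in B -> (emb F a <= N)%MS) -> (gen_mx B <= N)%MS.
Proof.
by move=> BN; apply/row_subP => i; rewrite rowK; apply: BN; exact: mem_nth.
Qed.

Lemma emb_sub_gen_mx B a : a \in B -> (emb F a <= gen_mx B)%MS.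
Proof. by move=> /row_gen_mx[i <-]; exact: row_sub. Qed.

Lemma exists_annihilator n (N : 'M[F]_(n, d)) (x : 'rV[F]_d) :
  ~~ (x <= N)%MS -> exists2 u : 'cV[F]_d, N *m u = 0 & x *m u != 0.
Proof.
rewrite submxE => /rV0Pn[i xi]; exists (col i (cokermx N)).
  by rewrite colE mulmxA mulmx_coker mul0mx.
apply: contraNneq xi; rewrite colE mulmxA -colE => /colP/(_ 0).
by rewrite [LHS]mxE [RHS]mxE => ->.
Qed.

Lemma exists_kernel n (N : 'M[F]_(n, d)) : (\rank N < d)%N ->
  exists2 u : 'cV[F]_d, N *m u = 0 & u != 0.
Proof.
move=> ltd; have /row_subPn[i xi] : ~~ (1%:M <= N)%MS.
  by apply: contraL ltd => /mxrankS; rewrite mxrank1 -leqNgt.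
have [u Nu xu] := exists_annihilator xi; exists u => //.
by apply: contraNneq xu => ->; rewrite mulmx0.
Qed.

(** The kernel has dimension one. *)
Lemma kernel_line n (N : 'M[F]_(n, d)) (u v : 'cV[F]_d) : (\rank N).+1 = d ->
  N *m u = 0 -> N *m v = 0 -> v != 0 -> exists c, u = c *: v.
Proof.
move=> rN Nu Nv v0.
have sub_ker (w : 'cV[F]_d) : N *m w = 0 -> (w^T <= kermx N^T)%MS.
  by move=> Nw; apply/sub_kermxP; rewrite -trmx_mul Nw trmx0.
have rK : \rank (kermx N^T) = 1%N by rewrite mxrank_ker mxrank_tr; move: rN; lia.
have rv : \rank v^T = 1%N by rewrite rank_rV trmx_eq0 v0.
have [_ /esym vK] := mxrank_leqif_sup (sub_ker v Nv).
move: vK; rewrite rK rv eqxx => Kv.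
have /sub_rVP[c uc] := submx_trans (sub_ker u Nu) Kv.
by exists c; rewrite -[u]trmxK uc linearZ /= trmxK.
Qed.

End RowSpan.

Section Rational.
Variables (R : realType) (d : nat).
Implicit Types (B : {fset 'rV[int]_d}) (u : 'cV[int]_d).

Lemma map_emb_ratr (a : 'rV[int]_d) : map_mx (ratr : rat -> R) (emb rat a) = emb R a.
Proof. by apply/rowP => i; rewrite !mxE ratr_int. Qed.

Lemma map_gen_mx_ratr B : map_mx (ratr : rat -> R) (gen_mx rat B) = gen_mx R B.
Proof. by apply/matrixP => i j; rewrite !mxE ratr_int. Qed.

Lemma rank_gen_mx_rat B : \rank (gen_mx rat B) = \rank (gen_mx R B).
Proof. by rewrite -map_gen_mx_ratr mxrank_map. Qed.

Lemma emb_sub_gen_mx_rat B a :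
  (emb R a <= gen_mx R B)%MS = (emb rat a <= gen_mx rat B)%MS.
Proof. by rewrite -map_gen_mx_ratr -map_emb_ratr map_submx. Qed.

Lemma clear_denominators m n (N : 'M[rat]_(m, n)) :
  exists k (Z : 'M[int]_(m, n)), k.+1%:R *: N = map_mx intr Z.
Proof.
have [k kP] : exists k, forall x, x \in [seq N p.1 p.2 | p <- enum {: 'I_m * 'I_n}] ->
    exists z : int, k.+1%:R * x = z%:~R.
  elim: [seq _ | _ <- _] => [|x s [k kP]]; first by exists 0%N.
  have den0 : (`|denq x|.-1.+1 = `|denq x|)%N by rewrite prednK // absz_gt0 denq_neq0.
  exists (k.+1 * `|denq x|).-1 => y.
  rewrite prednK ?muln_gt0 ?absz_gt0 ?denq_neq0 //.
  have denE : (`|denq x|%N)%:R = (denq x)%:~R :> rat by rewrite natr_absz normr_denq.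
  rewrite inE => /predU1P[->|/kP[z zE]].
    exists (k.+1%:Z * numq x); rewrite natrM -mulrA denE rmorphM /=.
    by rewrite numqE (mulrC x) -pmulrn.
  exists ((denq x) * z); rewrite natrM denE mulrAC zE rmorphM /= mulrC //.
have ex i j : exists z : int, k.+1%:R * N i j = z%:~R.
  by apply: kP; apply/mapP; exists (i, j); rewrite ?mem_enum.
have /choice[f fP] (p : 'I_m * 'I_n) := ex p.1 p.2.
by exists k, (\matrix_(i, j) f (i, j)); apply/matrixP => i j; rewrite !mxE (fP (i, j)).
Qed.

(** The vector y is the combination of the elements of B with coefficients
    y (pinvmx B), and the denominators of pinvmx B do not depend on y. *)
Lemma span_torsion B : exists k, forall y : 'rV[int]_d,
  emb R y \in fspan R B -> ZZ B (y *+ k.+1).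
Proof.
have [k [Z ZE]] := clear_denominators (pinvmx (gen_mx rat B)).
exists k => y; rewrite fspanP emb_sub_gen_mx_rat => /mulmxKpV yE.
have [c cE] : exists c, c = y *m Z by exists (y *m Z).
exists (fun a => if insub (index a (enum_fset B)) is Some i then c 0 i else 0).
have intrI : injective (intr : int -> rat) by exact: intr_inj.
have yc : y *+ k.+1 = \sum_i c 0 i *: nth 0 (enum_fset B) i.
  suff /rowP E : map_mx intr (y *+ k.+1) =
      map_mx (intr : int -> rat) (\sum_i c 0 i *: nth 0 (enum_fset B) i).
    by apply/rowP => j; apply: intrI; have := E j; rewrite [LHS]mxE [RHS]mxE.
  rewrite raddfMn /= -/(emb rat y) -[in LHS]yE -scaler_nat scalemxAl.
  rewrite scalemxAr ZE -map_mxM -cE mulmx_sum_row raddf_sum; apply: eq_bigr => i _.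
  by rewrite rowK; apply/rowP => j; rewrite !mxE; exact: esym (intrM _ _ _).
rewrite yc (big_nth 0) big_mkord; apply: eq_bigr => i _.
rewrite index_uniq ?fset_uniq // insubT //= => lt.
by rewrite -scaler_int intz; congr (c 0 _ *: _); apply: val_inj.
Qed.

(** The values of u form a subgroup of Z, generated by its least positive
    element g. *)
Lemma primitive_form u : u != 0 ->
  exists v e (g : int), [/\ lform v e = 1, g != 0 & forall x, lform u x = g * lform v x].
Proof.
move=> /cV0Pn[i ui].
have ex : exists n, `[< exists x, lform u x = n.+1%:Z >].
  exists `|u i 0|.-1; apply/asboolP.
  exists ((delta_mx 0 i : 'rV[int]_d) *~ Num.sg (u i 0)).
  rewrite lformMz /lform -rowE mxE prednK ?absz_gt0 //.
  by rewrite mulrC -normrEsg abszE.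
case: (ex_minnP ex) => n /asboolP[e eE] nmin; pose g := n.+1%:Z.
have g_dvd x : lform u x = g * (lform u x %/ g)%Z.
  have := divz_eq (lform u x) g; rewrite mulrC.
  have r0 := modz_ge0 (lform u x) (isT : g != 0).
  have rg := ltz_pmod (lform u x) (isT : 0 < g).
  have rE : lform u (x - e *~ (lform u x %/ g)%Z) = (lform u x %% g)%Z.
    rewrite lformB lformMz eE -/g {1}(divz_eq (lform u x) g).
    by rewrite (mulrC g) addrAC subrr add0r.
  case: (modz (lform u x) g) r0 rg rE => // -[|r] _ rg rE; first by rewrite addr0.
  have : (n <= r)%N by apply: nmin; apply/asboolP; exists (x - e *~ (lform u x %/ g)%Z).
  by move: rg; rewrite /g; lia.
have vE x : lform u x = g * lform (\col_i divz (u i 0) g) x.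
  rewrite /lform !mxE mulr_sumr; apply: eq_bigr => j _; rewrite mxE mulrCA.
  by congr (_ * _); have := g_dvd (delta_mx 0 j); rewrite /lform -rowE !mxE.
exists (\col_i divz (u i 0) g), e, g; split=> //.
by apply: (@mulfI _ g) => //; rewrite -vE eE mulr1.
Qed.

End Rational.

(** * Faces and facets of a rational cone *)

Section Faces.
Variables (R : realType) (d : nat) (A : {fset 'rV[int]_d}).
Implicit Types (F H : 'cV[R]_d) (x y : 'rV[R]_d) (sigma tau : set 'rV[R]_d).
Local Notation emb := (emb R).
Local Notation form := Defs.form.

Lemma form_add F x y : form F (x + y) = form F x + form F y.
Proof. by rewrite /form mulmxDl mxE. Qed.

Lemma form_scale F c x : form F (c *: x) = c * form F x.
Proof. by rewrite /form -scalemxAl mxE. Qed.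

Lemma form_sum F (I : Type) (s : seq I) (G : I -> 'rV[R]_d) :
  form F (\sum_(i <- s) G i) = \sum_(i <- s) form F (G i).
Proof.
elim: s => [|i s IHs]; first by rewrite !big_nil /form mul0mx mxE.
by rewrite !big_cons form_add IHs.
Qed.

Lemma form_lincomb c F H x : form (F - c *: H) x = form F x - c * form H x.
Proof. by rewrite /form mulmxBr -scalemxAr !mxE. Qed.

Lemma form_scalel c F x : form (c *: F) x = c * form F x.
Proof. by rewrite /form -scalemxAr mxE. Qed.

Lemma form_eq0_mul F x : (form F x == 0) = (x *m F == 0).
Proof.
apply/eqP/eqP => [F0|F0]; last by rewrite /form F0 mxE.
by apply/rowP => i; rewrite !ord1 [RHS]mxE -F0.
Qed.

Lemma form_int (u : 'cV[int]_d) a : form (map_mx intr u) (emb a) = (lform u a)%:~R.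
Proof. by rewrite /form /emb -map_mxM mxE. Qed.

Definition nonneg F : Prop := forall a, a \in A -> 0 <= form F (emb a).

Definition zeros F : {fset 'rV[int]_d} := [fset a in A | form F (emb a) == 0]%fset.

Lemma zerosP F a : (a \in zeros F) = (a \in A) && (form F (emb a) == 0).
Proof. by rewrite !inE. Qed.

Lemma gen_mx_zeros F : gen_mx R (zeros F) *m F = 0.
Proof.
apply/eqP/gen_mx_mul0 => a; rewrite zerosP => /andP[_].
by rewrite form_eq0_mul => /eqP.
Qed.

Lemma cone_gen a : a \in A -> cone (R := R) A (emb a).
Proof.
move=> aA; exists (fun a' => (a' == a)%:R) => [a'|]; first exact: ler0n.
rewrite (big_fsetD1 a) //= eqxx scale1r big_seq big1 ?addr0 // => a'.
by rewrite in_fsetD1 => /andP[/negPf-> _]; rewrite scale0r.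
Qed.

Lemma cone_nonneg F : (forall x, cone A x -> 0 <= form F x) <-> nonneg F.
Proof.
split=> [F_ge0 a aA|F_ge0 x [c c_ge0 ->]]; first exact/F_ge0/cone_gen.
rewrite form_sum big_seq sumr_ge0 // => a aA.
by rewrite form_scale mulr_ge0 // F_ge0.
Qed.

Definition null_face F : set 'rV[R]_d := cone A `&` [set x | form F x = 0].

Lemma face_gens_null F : face_gens A (null_face F) = zeros F.
Proof.
apply/fsetP => a; rewrite zerosP !inE; apply: andb_id2l => aA.
apply/idP/eqP => [/set_mem[]//|F0]; apply: mem_set; split=> //.
exact: cone_gen.
Qed.

Lemma is_faceP tau : is_face (cone A) tau <->
  exists2 F, nonneg F & tau = null_face F.
Proof. by split=> -[F /cone_nonneg ? ->]; exists F. Qed.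

(** In a combination of generators with nonnegative coefficients killed by F,
    every term is killed by F. *)
Lemma null_face_span F H x : nonneg F -> null_face F x ->
  (forall a, a \in zeros F -> form H (emb a) = 0) -> form H x = 0.
Proof.
move=> F_ge0 [[c c_ge0 ->] /= F0] H0; rewrite form_sum big_seq big1 // => a aA.
move: F0 => /eqP; rewrite form_sum big_seq psumr_eq0; last first.
  by move=> a' a'A; rewrite form_scale mulr_ge0 // F_ge0.
move=> /allP/(_ a aA); rewrite aA /= !form_scale mulf_eq0 => /orP[/eqP->|Fa].
  by rewrite mul0r.
by rewrite H0 ?mulr0 // zerosP aA.
Qed.

Lemma null_face_sub F H : nonneg F ->
  {subset zeros F <= zeros H} -> null_face F `<=` null_face H.
Proof.
move=> F_ge0 FH x Fx; split; first by case: Fx.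
apply: null_face_span Fx _ => // a /FH.
by rewrite zerosP => /andP[_ /eqP].
Qed.

Hypothesis A_gen : ZZ A = setT.

Lemma gen_mx_full n (N : 'M[R]_(n, d)) : (N <= gen_mx R A)%MS.
Proof.
have embA a : (emb a <= gen_mx R A)%MS.
  have [c ->] : ZZ A a by rewrite A_gen.
  rewrite /emb raddf_sum big_seq summx_sub // => a' aA /=.
  rewrite raddfMz -scaler_int; apply/scalemx_sub; exact: emb_sub_gen_mx.
apply: (submx_trans (submx1 N)); apply/row_subP => i.
suff -> : row i (1%:M : 'M[R]_d) = emb (delta_mx 0 i) by [].
by rewrite row1; apply/rowP => j; rewrite !mxE; case: (_ && _).
Qed.

Lemma rank_gen_mx : \rank (gen_mx R A) = d.
Proof.
apply/eqP; rewrite eqn_leq rank_leq_col /=.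
by have := mxrankS (gen_mx_full 1%:M); rewrite mxrank1.
Qed.

Lemma form_neq0_gen F : F != 0 -> exists2 a, a \in A & form F (emb a) != 0.
Proof.
move=> F0; apply: contrapT => noa; case/negP: F0; apply/eqP.
have AF : gen_mx R A *m F = 0.
  apply/eqP/gen_mx_mul0 => a aA; apply/eqP; rewrite -form_eq0_mul.
  by apply: contrapT => /negP Fa; apply: noa; exists a.
have /submxP[D DE] := gen_mx_full 1%:M.
by rewrite -[F]mul1mx DE -mulmxA AF mulmx0.
Qed.

Lemma zeros_rank_lt F : F != 0 -> (\rank (gen_mx R (zeros F)) < d)%N.
Proof.
move=> F0; rewrite ltn_neqAle rank_leq_col andbT; apply: contra F0 => /eqP full.
have : row_full (gen_mx R (zeros F)) by rewrite /row_full full.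
move=> /row_fullP[D DE].
by rewrite -[F]mul1mx -DE -mulmxA gen_mx_zeros mulmx0.
Qed.

Lemma facets_null F : nonneg F -> (\rank (gen_mx R (zeros F))).+1 = d ->
  facets A (null_face F).
Proof.
move=> F_ge0 rF; split; first by apply/is_faceP; exists F.
by rewrite face_gens_null fspan_dim.
Qed.

Lemma facetsP sigma : facets A sigma ->
  exists F, [/\ nonneg F, F != 0, sigma = null_face F
    & (\rank (gen_mx R (zeros F))).+1 = d].
Proof.
move=> [/is_faceP[F F_ge0 ->]]; rewrite face_gens_null fspan_dim => rF.
exists F; split=> //; apply: contra_eq_neq rF => F0.
suff -> : zeros F = A by rewrite rank_gen_mx; lia.
by apply/fsetP => a; rewrite zerosP F0 /form mulmx0 mxE eqxx andbT.
Qed.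

(** The zeros of F span a rational hyperplane, which is the kernel of a
    primitive integral form. *)
Lemma integral_form F : nonneg F -> F != 0 -> (\rank (gen_mx R (zeros F))).+1 = d ->
  exists u : 'cV[int]_d, (exists e, lform u e = 1) /\
    exists2 c : R, 0 < c & F = c *: map_mx intr u.
Proof.
move=> F_ge0 F0 rF.
have [q Zq q0] : exists2 q : 'cV[rat]_d, gen_mx rat (zeros F) *m q = 0 & q != 0.
  by apply: exists_kernel; rewrite (rank_gen_mx_rat R) -[X in (_ < X)%N]rF.
have [k [Q qE]] := clear_denominators q.
have Q0 : Q != 0.
  apply: contra q0 => /eqP Q0; move: qE; rewrite Q0 map_mx0 => /eqP.
  by rewrite scaler_eq0 pnatr_eq0.
have QF a : a \in zeros F -> lform Q a = 0.
  move=> aF; apply: (@intr_inj rat); rewrite rmorph0.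
  have /eqP/gen_mx_mul0/(_ a aF) aq := Zq.
  have := congr1 (fun M : 'M_1 => k.+1%:R * M 0 0) aq.
  rewrite [X in _ = _ * X]mxE mulr0 => <-.
  transitivity ((Defs.emb rat a *m map_mx intr Q) 0 0).
    by rewrite /Defs.emb -map_mxM mxE.
  by rewrite -qE -scalemxAr mxE.
have [v [e [g [ve g0 Qv]]]] := primitive_form Q0.
have vF a : a \in zeros F -> lform v a = 0.
  by move=> /QF /eqP; rewrite Qv mulf_eq0 (negPf g0) => /eqP.
have v0 : map_mx intr v != 0 :> 'cV[R]_d.
  apply: contra_eq_neq ve => v0; have := form_int v e.
  rewrite v0 /form mulmx0 mxE => /esym /eqP; rewrite intr_eq0 => /eqP->.
  by rewrite eq_sym oner_eq0.
have Fv : gen_mx R (zeros F) *m map_mx intr v = 0.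
  apply/eqP/gen_mx_mul0 => a aF; apply/eqP.
  by rewrite -form_eq0_mul form_int vF.
have [c FE] := kernel_line rF (gen_mx_zeros F) Fv v0.
have c0 : c != 0 by apply: contra F0 => /eqP c0; rewrite FE c0 scale0r.
have [c_lt0|c_gt0] : c < 0 \/ 0 < c by apply/orP; rewrite -neq_lt.
  exists (- v); split.
    by exists (- e); rewrite lformN /lform mulmxN mxE -/(lform v e) ve opprK.
  by exists (- c); rewrite ?oppr_gt0 // map_mxN scalerN scaleNr opprK.
by exists v; split; [exists e|exists c].
Qed.

(** Both the form F that defines the facet and its chosen facet form are
    multiples of the primitive integral form vanishing on the facet. *)
Lemma facet_formP sigma : facets A sigma -> exists u : 'cV[int]_d,
  [/\ facet_form A sigma = map_mx intr u,
    forall a, a \in A -> 0 <= lform u a,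
    exists e, lform u e = 1,
    sigma = null_face (map_mx intr u)
  & (\rank (gen_mx R (zeros (map_mx intr u)))).+1 = d].
Proof.
move=> /facetsP[F [F_ge0 F0 -> rF]].
have [v [[e ve] [c c_gt0 FE]]] := integral_form F_ge0 F0 rF.
have vE x : form (map_mx intr v) x = c^-1 * form F x.
  by rewrite FE form_scalel mulrA mulVf ?mul1r // gt_eqF.
have v_form : is_facet_form A (null_face F) (map_mx intr v).
  split=> [x Ax|x [_ /= Fx]|].
  - by rewrite vE mulr_ge0 ?invr_ge0 ?(ltW c_gt0) ?((cone_nonneg F).2 F_ge0).
  - by rewrite vE Fx mulr0.
  - apply/seteqP; split=> [_ [a _ <-]|_ [n _ <-]].
      by exists (lform v a) => //; rewrite form_int.
    by exists (e *~ n) => //; rewrite form_int lformMz ve mul1r.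
have : is_facet_form A (null_face F) (facet_form A (null_face F)).
  by apply: (@xgetPex _ 0 (is_facet_form A (null_face F))); exists (map_mx intr v).
set H := facet_form _ _ => -[H_ge0 HF H_int].
have {}H_ge0 : nonneg H by apply/cone_nonneg.
have entry i : exists n : int, H i 0 = n%:~R.
  have : (range (intr : int -> R)) (H i 0).
    rewrite -H_int; exists (delta_mx 0 i) => //.
    by rewrite /form /Defs.emb map_delta_mx -rowE mxE.
  by move=> [n _ <-]; exists n.
have [f fP] := choice entry.
have HE : H = map_mx intr (\col_i f i) by apply/colP => i; rewrite !mxE fP.
have HF0 : gen_mx R (zeros F) *m H = 0.
  apply/eqP/gen_mx_mul0 => a; rewrite zerosP => /andP[aA /eqP Fa].
  by apply/eqP; rewrite -form_eq0_mul HF //; split=> //; exact: cone_gen.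
have [c' Hc'] := kernel_line rF HF0 (gen_mx_zeros F) F0.
have [e' He'] : exists e', form H (emb e') = 1.
  have : (range (intr : int -> R)) 1 by exists 1.
  by rewrite -H_int => -[e' _ He']; exists e'.
have c'0 : c' != 0.
  apply: contra_eq_neq He' => c'E.
  by rewrite Hc' c'E form_scalel mul0r eq_sym oner_eq0.
have HF_eq x : (form H x == 0) = (form F x == 0).
  by rewrite Hc' form_scalel mulf_eq0 (negPf c'0).
have zHF : zeros H = zeros F by apply/fsetP => a; rewrite !zerosP HF_eq.
exists (\col_i f i); rewrite -HE; split=> //.
- move=> a aA; have := H_ge0 a aA; rewrite HE form_int ler0z //.
- by exists e'; apply: (@intr_inj R); rewrite -form_int -HE.
- apply/seteqP; split=> x [Ax /eqP Fx]; split=> //=; apply/eqP.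
    by rewrite HF_eq.
  by rewrite -HF_eq.
- by rewrite zHF.
Qed.

Lemma seq_argmin (T : eqType) (s : seq T) (f : T -> R) : s != [::] ->
  exists2 a, a \in s & forall c, c \in s -> f a <= f c.
Proof.
elim: s => // a [|a1 s] IHs _.
  by exists a => [|c]; rewrite inE // => /eqP->.
have [//|c cs cmin] := IHs.
have [le|lt] := leP (f a) (f c).
  exists a; first exact: mem_head.
  move=> e; rewrite inE => /predU1P[->//|/cmin]; exact: le_trans.
exists c; first by rewrite inE cs orbT.
by move=> e; rewrite inE => /predU1P[->|/cmin//]; exact: ltW.
Qed.

(** Move from F in the direction of -H up to the first generator at which the
    form vanishes. *)
Lemma nonneg_step F H : nonneg F ->
  (forall a, a \in zeros F -> form H (emb a) = 0) ->
  (exists2 a, a \in A & 0 < form H (emb a)) ->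
  exists2 t, 0 < t & nonneg (F - t *: H) /\
    exists2 a, a \in A & 0 < form F (emb a) /\ form (F - t *: H) (emb a) = 0.
Proof.
move=> F_ge0 HF [a0 a0A Ha0].
pose s := [seq a <- enum_fset A | 0 < form H (emb a)].
have s0 : s != [::] by apply/eqP => s0; have : a0 \in s;
  [rewrite mem_filter Ha0|rewrite s0].
have [a] := seq_argmin (fun a => form F (emb a) / form H (emb a)) s0.
rewrite mem_filter => /andP[Ha aA] amin.
have Fa : 0 < form F (emb a).
  rewrite lt_neqAle F_ge0 // andbT eq_sym; apply: contraTneq Ha => Fa.
  by rewrite HF ?ltxx // zerosP aA Fa eqxx.
exists (form F (emb a) / form H (emb a)); first exact: divr_gt0.
split=> [a' a'A|]; last first.
  exists a => //; split=> //; rewrite form_lincomb divfK ?subrr //.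
  by rewrite gt_eqF.
rewrite form_lincomb subr_ge0.
have [Ha'|Ha'] := ltP 0 (form H (emb a')).
  by rewrite -ler_pdivlMr // amin // mem_filter Ha'.
apply: le_trans (F_ge0 a' a'A).
by rewrite mulr_ge0_le0 // ltW // divr_gt0.
Qed.

(** A nonnegative form whose zeros span less than a hyperplane is a positive
    combination of two nonnegative forms with more zeros. Induction on the
    dimension of the span of the zeros leads to facet forms, one of which is
    nonzero at x if F is. *)
Lemma nonneg_facet F x : nonneg F -> form F x != 0 ->
  exists2 sigma, facets A sigma &
    {subset zeros F <= zeros (facet_form A sigma)} /\
    form (facet_form A sigma) x != 0.
Proof.
have [n] := ubnP (d - \rank (gen_mx R (zeros F))).
elim: n F => // n IHn F ltn F_ge0 Fx.
have F0 : F != 0 by apply: contraNneq Fx => ->; rewrite /form mulmx0 mxE.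
have [rF|rF] := eqVneq (\rank (gen_mx R (zeros F))).+1 d.
  have sF := facets_null F_ge0 rF; exists (null_face F) => //.
  have [u [uE _ [e ue] sE _]] := facet_formP sF; rewrite uE.
  have zE : zeros F = zeros (map_mx intr u).
    by rewrite -!face_gens_null -sE.
  split; first by rewrite zE.
  have Zu := gen_mx_zeros (map_mx intr u); rewrite -zE in Zu.
  have [c uF] := kernel_line rF Zu (gen_mx_zeros F) F0.
  rewrite uF form_scalel mulf_neq0 //; apply: contra_eq_neq ue => c0.
  have := form_int u e; rewrite uF c0 form_scalel mul0r => /esym/eqP.
  by rewrite intr_eq0 => /eqP->; rewrite eq_sym oner_eq0.
have {}rF : ((\rank (gen_mx R (zeros F))).+1 < d)%N.
  by rewrite ltn_neqAle rF zeros_rank_lt.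
have [a1 a1A Fa1] := form_neq0_gen F0.
have [G GF G0] : exists2 G : 'cV[R]_d,
    col_mx (gen_mx R (zeros F)) (emb a1) *m G = 0 & G != 0.
  apply: exists_kernel; rewrite -addsmxE; apply: leq_ltn_trans rF.
  apply: (leq_trans (leq_of_leqif (mxrank_adds_leqif _ _))).
  by have := rank_leq_row (emb a1); lia.
rewrite mul_col_mx in GF.
wlog [a2 a2A Ga2] : G GF G0 / exists2 a, a \in A & 0 < form G (emb a).
  move=> wlogG; have [a aA] := form_neq0_gen G0; rewrite neq_lt => /orP[Ga|Ga].
    apply: (wlogG (- G)); rewrite ?oppr_eq0 //.
      by rewrite !mulmxN -opp_col_mx GF oppr0.
    by exists a => //; rewrite -scaleN1r form_scalel mulN1r oppr_gt0.
  by apply: (wlogG G) => //; exists a.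
move: GF; rewrite -[0]vsubmxK => /eq_col_mx[]; rewrite !linear0.
move=> /eqP/gen_mx_mul0 GF /eqP; rewrite -form_eq0_mul => /eqP Ga1.
have {}GF a : a \in zeros F -> form G (emb a) = 0.
  by move=> /GF/eqP; rewrite -form_eq0_mul => /eqP.
have sub H : (forall a, a \in zeros F -> form H (emb a) = 0) ->
    {subset zeros F <= zeros H}.
  move=> HF a aF; rewrite zerosP HF // eqxx andbT.
  by move: aF; rewrite zerosP => /andP[].
have close H : nonneg H -> (forall a, a \in zeros F -> form H (emb a) = 0) ->
    (exists2 a, a \in A & 0 < form F (emb a) /\ form H (emb a) = 0) ->
    form H x != 0 -> exists2 sigma, facets A sigma &
      {subset zeros F <= zeros (facet_form A sigma)} /\
      form (facet_form A sigma) x != 0.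
  move=> H_ge0 HF [a aA [Fa Ha]] Hx.
  have le : (gen_mx R (zeros F) <= gen_mx R (zeros H))%MS.
    by apply: gen_mx_sub => a' /(sub _ HF); exact: emb_sub_gen_mx.
  have lt : (d - \rank (gen_mx R (zeros H)) < n)%N.
    have [rle] := mxrank_leqif_sup le.
    have -> : (gen_mx R (zeros H) <= gen_mx R (zeros F))%MS = false.
      apply/negbTE/negP => ge.
      have aH : a \in zeros H by rewrite zerosP aA Ha eqxx.
      have /submxP[D aE] := submx_trans (emb_sub_gen_mx R aH) ge.
      by move: Fa; rewrite /Defs.form aE -mulmxA gen_mx_zeros mulmx0 mxE ltxx.
    move: (\rank _) (\rank _) ltn rF rle => r r' ltn rF rle.
    move=> /negbT; rewrite eqn_leq rle /= -ltnNge => lt_rr'.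
    by apply: leq_trans (ltn_sub2l (ltnW rF) lt_rr') _.
  have [sigma sF [Hs sx]] := IHn H lt H_ge0 Hx.
  by exists sigma => //; split=> // a' /(sub _ HF)/Hs.
have [t t0 [F1_ge0 F1_new]] := nonneg_step F_ge0 GF (ex_intro2 _ _ a2 a2A Ga2).
set F1 := F - t *: G in F1_ge0 F1_new.
have F1F a : a \in zeros F -> form F1 (emb a) = 0.
  move=> aF; rewrite form_lincomb GF // mulr0 subr0.
  by move: aF; rewrite zerosP => /andP[_ /eqP].
have F1a1 : 0 < form F1 (emb a1).
  by rewrite form_lincomb Ga1 mulr0 subr0 lt_neqAle eq_sym Fa1 F_ge0.
have [s s0 [F2_ge0 F2_new]] := nonneg_step F_ge0 F1F (ex_intro2 _ _ a1 a1A F1a1).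
set F2 := F - s *: F1 in F2_ge0 F2_new.
have F2F a : a \in zeros F -> form F2 (emb a) = 0.
  move=> aF; rewrite form_lincomb F1F // mulr0 subr0.
  by move: aF; rewrite zerosP => /andP[_ /eqP].
have [F1x|] := eqVneq (form F1 x) 0; last exact: close.
by apply: (close F2) => //; rewrite form_lincomb F1x mulr0 subr0.
Qed.

(** If x is not in the span, some form G vanishes on the face and not at x. For
    small t > 0 both F and F + t G are nonnegative and vanish on the face, and
    they cannot both vanish at x: nonneg_facet applies to one of them. *)
Lemma face_span F x : nonneg F ->
  (forall sigma, facets A sigma ->
     {subset zeros F <= zeros (facet_form A sigma)} ->
     form (facet_form A sigma) x = 0) ->
  (x <= gen_mx R (zeros F))%MS.
Proof.
move=> F_ge0 facet0; apply: contraT => /exists_annihilator[G GF Gx].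
have nonneg0 H : nonneg H -> (forall a, a \in zeros F -> form H (emb a) = 0) ->
    form H x = 0.
  move=> H_ge0 HF; apply/eqP; apply: contraT => Hx.
  have [sigma sF [Hs /eqP[]]] := nonneg_facet H_ge0 Hx.
  apply: facet0 => // a aF; apply: Hs.
  by rewrite zerosP HF // eqxx andbT; move: aF; rewrite zerosP => /andP[].
have FF a : a \in zeros F -> form F (emb a) = 0.
  by rewrite zerosP => /andP[_ /eqP].
have NGF a : a \in zeros F -> form (- G) (emb a) = 0.
  move=> aF; apply/eqP; rewrite form_eq0_mul mulmxN oppr_eq0.
  by move/eqP/gen_mx_mul0: GF => /(_ a aF) ->.
have [t t0 Ft] : exists2 t, 0 < t & nonneg (F - t *: - G).
  have [[a aA Ga]|noa] := pselect (exists2 a, a \in A & 0 < form (- G) (emb a)).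
    have [t t0 [Ft _]] := nonneg_step F_ge0 NGF (ex_intro2 _ _ a aA Ga).
    by exists t.
  exists 1 => // a aA; rewrite form_lincomb mul1r subr_ge0.
  apply: le_trans (F_ge0 a aA); rewrite leNgt; apply/negP => Ga.
  by apply: noa; exists a.
have := nonneg0 _ Ft; rewrite form_lincomb (nonneg0 F) // sub0r => /(_ _)/eqP.
rewrite oppr_eq0 mulf_eq0 gt_eqF //= form_eq0_mul mulmxN oppr_eq0 (negPf Gx).
by move=> -> // a aF; rewrite form_lincomb FF // NGF // mulr0 subr0.
Qed.

End Faces.

(** * Facet normals *)

Section Normals.
Variables (R : realType) (d : nat) (A : {fset 'rV[int]_d}).
Implicit Types (u v : 'cV[int]_d) (x y : 'rV[int]_d).
Hypothesis A_gen : ZZ A = setT.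

Definition normal u : Prop :=
  exists2 sigma : set 'rV[R]_d, facets A sigma & facet_form A sigma = map_mx intr u.

Definition face_of u : set 'rV[R]_d := null_face A (map_mx intr u).

Definition gens_of u : {fset 'rV[int]_d} := zeros A (map_mx intr u : 'cV[R]_d).

Lemma gens_ofP u a : (a \in gens_of u) = (a \in A) && (lform u a == 0).
Proof. by rewrite zerosP form_int intr_eq0. Qed.

Lemma face_gens_of u : face_gens A (face_of u) = gens_of u.
Proof. exact: face_gens_null. Qed.

Lemma gens_of0 u a : a \in gens_of u -> lform u a = 0.
Proof. by rewrite gens_ofP => /andP[_ /eqP]. Qed.

Lemma map_intr_inj u v : map_mx intr u = map_mx intr v :> 'cV[R]_d -> u = v.
Proof.
move=> uv; apply/colP => i; apply: (@intr_inj R).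
by have /colP/(_ i) := uv; rewrite !mxE.
Qed.

Lemma normal_spec u : normal u -> [/\ facets A (face_of u),
  facet_form A (face_of u) = map_mx intr u, forall a, a \in A -> 0 <= lform u a,
  exists e, lform u e = 1 & (\rank (gen_mx R (gens_of u))).+1 = d].
Proof.
move=> [sigma sF uE]; have [v [vE v_ge0 ve sE rv]] := facet_formP A_gen sF.
have -> : u = v by apply: map_intr_inj; rewrite -uE vE.
by rewrite /face_of -sE.
Qed.

Lemma facet_normal sigma : facets A sigma ->
  exists2 u, normal u & sigma = face_of u.
Proof.
move=> sF; have [u [uE _ _ sE _]] := facet_formP A_gen sF.
by exists u => //; exists sigma.
Qed.

Lemma FsigmaE u x : normal u -> Fsigma A (face_of u) x = (lform u x)%:~R.
Proof. by move=> /normal_spec[_ uE _ _ _]; rewrite /Fsigma uE form_int. Qed.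

Lemma normal_neq0 u : normal u -> map_mx intr u != 0 :> 'cV[R]_d.
Proof.
move=> /normal_spec[_ _ _ [e ue] _]; apply: contra_eq_neq ue => u0.
have := form_int R u e; rewrite u0 /Defs.form mulmx0 mxE => /esym/eqP.
by rewrite intr_eq0 => /eqP->; rewrite eq_sym oner_eq0.
Qed.

(** Both normals vanish on a set of rank d - 1, so they are proportional, define
    the same facet, and are equal to its facet form. *)
Lemma normal_inj u v : normal u -> normal v ->
  (forall a, a \in gens_of u -> lform v a = 0) -> u = v.
Proof.
move=> nu nv uv; have [_ uE _ _ ru] := normal_spec nu; have [_ vE _ _ _] := normal_spec nv.
have Zv : gen_mx R (gens_of u) *m map_mx intr v = 0.
  apply/eqP/gen_mx_mul0 => a au; apply/eqP.
  by rewrite -form_eq0_mul form_int uv.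
have [c ucv] := kernel_line ru (gen_mx_zeros _ _) Zv (normal_neq0 nv).
have c0 : c != 0.
  by apply: contraNneq (normal_neq0 nu) => c0; rewrite ucv c0 scale0r.
have formE (x : 'rV[R]_d) : (Defs.form (map_mx intr u) x == 0) =
    (Defs.form (map_mx intr v) x == 0).
  by rewrite ucv form_scalel mulf_eq0 (negPf c0).
have fE : face_of u = face_of v.
  by apply/seteqP; split=> x [Ax /eqP x0]; split=> //; apply/eqP;
     [rewrite -formE|rewrite formE].
by apply: map_intr_inj; rewrite -uE -vE fE.
Qed.

(** The generators on a facet span the kernel of its normal. *)
Lemma gens_of_dense u y : normal u -> lform u y = 0 ->
  exists2 k, (0 < k)%N & ZZ (gens_of u) (y *+ k).
Proof.
move=> nu uy; have [_ _ _ _ ru] := normal_spec nu.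
have [k kP] := span_torsion R (gens_of u); exists k.+1 => //; apply: kP.
rewrite fspanP; apply: contraT => /exists_annihilator[G ZG]; rewrite -form_eq0_mul.
have [c ->] := kernel_line ru ZG (gen_mx_zeros _ _) (normal_neq0 nu).
by rewrite form_scalel form_int uy mulr0 eqxx.
Qed.

(** A lattice point in the relative interior of the facet. *)
Definition barycenter u : 'rV[int]_d := \sum_(a <- gens_of u) a.

Lemma NN_barycenter u : NN (gens_of u) (barycenter u).
Proof. by exists (fun=> 1%N); apply: eq_bigr => a _; rewrite mulr1n. Qed.

Lemma lform_barycenter u : lform u (barycenter u) = 0.
Proof. by rewrite lform_sum big_seq big1 // => a /gens_of0. Qed.

Lemma lform_barycenter_gt0 u v : normal u -> normal v -> u != v ->
  0 < lform v (barycenter u).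
Proof.
move=> nu nv uv; have [_ _ v_ge0 _ _] := normal_spec nv.
have ge0 a : a \in gens_of u -> 0 <= lform v a.
  by rewrite gens_ofP => /andP[/v_ge0].
rewrite lform_sum lt_neqAle big_seq sumr_ge0 // andbT eq_sym.
apply: contra uv; rewrite psumr_eq0 // => /allP v0.
apply/eqP/normal_inj => // a au; apply/eqP.
by have := v0 a au; rewrite au.
Qed.

Lemma NN_lform_ge0 u x : normal u -> NN A x -> 0 <= lform u x.
Proof.
move=> /normal_spec[_ _ u_ge0 _ _] [c ->]; rewrite lform_sum big_seq sumr_ge0 // => a aA.
by rewrite lformMn mulrn_wge0 // u_ge0.
Qed.

(** A normal is determined by the set of generators on its facet. *)
Lemma normals_finite : exists2 U : seq 'cV[int]_d, uniq U &
  forall u, u \in U <-> normal u.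
Proof.
pose pick B := xget 0 [set u | normal u /\ gens_of u = B].
exists (undup [seq u <- [seq pick B | B <- enum_fset (fpowerset A)] | `[< normal u >]]).
  exact: undup_uniq.
move=> u; split.
  by rewrite mem_undup mem_filter => /andP[/asboolP].
move=> nu; rewrite mem_undup mem_filter; apply/andP; split; first exact/asboolP.
apply/mapP; exists (gens_of u).
  rewrite fpowersetE; apply/fsubsetP => a.
  by rewrite gens_ofP => /andP[].
have [nv vu] : normal (pick (gens_of u)) /\ gens_of (pick (gens_of u)) = gens_of u.
  by apply: (@xgetPex _ 0 [set v | normal v /\ gens_of v = gens_of u]); exists u.
apply: (normal_inj nu nv) => a; rewrite -{1}vu; exact: gens_of0.
Qed.

Definition contains_face u (tau : set 'rV[R]_d) : Prop :=
  forall a, a \in face_gens A tau -> lform u a = 0.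

Lemma face_kernel (tau : set 'rV[R]_d) y : is_face (cone A) tau ->
  (forall u, normal u -> contains_face u tau -> lform u y = 0) ->
  emb R y \in fspan R (face_gens A tau).
Proof.
move=> /is_faceP[F F_ge0 ->] y0; rewrite face_gens_null fspanP.
apply: (face_span A_gen) => // sigma sF; have [u [uE _ _ _ _]] := facet_formP A_gen sF.
rewrite uE form_int => sub; rewrite y0 //; first by exists sigma.
by move=> a; rewrite face_gens_null => /sub; rewrite -/(gens_of u) => /gens_of0.
Qed.

(** By face_span the face spans the whole space, so the form defining it
    vanishes on A. *)
Lemma face_in_no_facet (tau : set 'rV[R]_d) : is_face (cone A) tau ->
  (forall u, normal u -> ~ contains_face u tau) -> face_gens A tau = A.
Proof.
move=> tau_face no; have [F F_ge0 tE] := (is_faceP _ _).1 tau_face.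
rewrite tE face_gens_null; apply/fsetP => a; rewrite zerosP andb_idr // => aA.
have : emb R a \in fspan R (face_gens A tau).
  by apply: face_kernel => // u /no.
rewrite fspanP tE face_gens_null => /submxP[D ->].
by rewrite /Defs.form -mulmxA gen_mx_zeros mulmx0 mxE.
Qed.

Lemma contains_face_sub u (tau : set 'rV[R]_d) : is_face (cone A) tau ->
  contains_face u tau -> tau `<=` face_of u.
Proof.
move=> /is_faceP[F F_ge0 ->] cont; apply: null_face_sub => // a aF.
rewrite -/(gens_of u) gens_ofP; move: (aF); rewrite zerosP => /andP[-> _] /=.
by rewrite cont // face_gens_null.
Qed.

(** By face_span the face spans the hyperplane of the facet, and the form that
    defines the face vanishes on that hyperplane. *)
Lemma face_of_single_facet u (tau : set 'rV[R]_d) : normal u ->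
  is_face (cone A) tau -> contains_face u tau ->
  (forall v, normal v -> contains_face v tau -> v = u) -> tau = face_of u.
Proof.
move=> nu tau_face cont only; apply/seteqP; split.
  exact: contains_face_sub.
have [F F_ge0 tE] := (is_faceP _ _).1 tau_face.
rewrite tE; apply: null_face_sub => [a aA|a au].
  by have [_ _ u_ge0 _ _] := normal_spec nu; rewrite form_int ler0z u_ge0.
have := au; rewrite -/(gens_of u) gens_ofP => /andP[aA _].
rewrite zerosP aA /=.
have : emb R a \in fspan R (face_gens A tau).
  by apply: face_kernel => // v nv /(only v nv)->; exact: gens_of0.
rewrite fspanP tE face_gens_null => /submxP[D ->].
by rewrite /Defs.form -mulmxA gen_mx_zeros mulmx0 mxE.
Qed.

End Normals.

(** * The levels of the set along the facets *)

Lemma finite_int_segment (X : set int) (N : nat) :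
  (forall n, X n -> (`|n| <= N)%N) -> finite_set X.
Proof.
move=> XN; apply: (@sub_finite_set _ _ [set i%:Z - N%:Z | i in `I_(N + N).+1]).
  move=> n /XN nN; exists (absz (n + N%:Z)); last by lia.
  by rewrite /mkset; lia.
by apply: finite_image; exact: finite_II.
Qed.

Section Levels.
Variables (R : realType) (d : nat) (A : {fset 'rV[int]_d}).
Variables (Sc S : set 'rV[int]_d) (m : nat).
Variables (b : 'I_m -> 'rV[int]_d) (tau : 'I_m -> set 'rV[R]_d).
Hypotheses (A_gen : ZZ A = setT) (Sc_NN : is_NNset A Sc) (Sc_fg : fin_gen A Sc)
  (Sc_scored : scored R A Sc)
  (tau_face : forall i, is_face (cone A) (tau i))
  (SE : S = Sc `\` \bigcup_i hole b tau A i)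
  (S_levels : forall sigma : set 'rV[R]_d, facets A sigma ->
     Fsigma A sigma @` S = Fsigma A sigma @` Sc)
  (S_NN : is_NNset A S).
Implicit Types (u v : 'cV[int]_d) (x y : 'rV[int]_d).
Local Notation normal := (@normal R d A).
Local Notation face_of := (@face_of R d A).
Local Notation gens_of := (@gens_of R d A).
Local Notation barycenter := (@barycenter R d A).
Local Notation contains_face := (contains_face A).

Lemma holeP i x : hole b tau A i x <-> ZZ (face_gens A (tau i)) (x - b i).
Proof.
split=> [[_ -> [y Zy <-]]|Zx]; first by rewrite addrAC subrr add0r.
by exists (b i) => //; exists (x - b i) => //; rewrite subrKC.
Qed.

Lemma SP x : S x <-> Sc x /\ forall i, ~ hole b tau A i x.
Proof.
rewrite SE; split=> [[Sx nx]|[Sx nx]]; split=> //.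
  by move=> i hx; apply: nx; exists i.
by move=> [i _ /nx].
Qed.

Lemma lform_hole u i x : contains_face u (tau i) -> hole b tau A i x ->
  lform u x = lform u (b i).
Proof.
move=> cont /holeP /(lform_ZZ cont) /eqP.
by rewrite lformB subr_eq0 => /eqP.
Qed.

Lemma scoredP x :
  (forall u, normal u -> exists2 y, Sc y & lform u y = lform u x) -> Sc x.
Proof.
move=> lev; rewrite Sc_scored => sigma /(facet_normal A_gen)[u nu ->].
have [y Sy uy] := lev u nu; exists y => //.
by rewrite !FsigmaE // uy.
Qed.

Lemma S_level u y : normal u -> Sc y -> exists2 x, S x & lform u x = lform u y.
Proof.
move=> nu Sy; have [uF _ _ _ _] := normal_spec A_gen nu.
have : (Fsigma A (face_of u) @` Sc) (Fsigma A (face_of u) y) by exists y.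
rewrite -S_levels // => -[x Sx]; rewrite !FsigmaE // => /intr_inj xy.
by exists x.
Qed.

Lemma NN_sub (B : {fset 'rV[int]_d}) x : {subset B <= A} -> NN B x -> NN A x.
Proof.
move=> BA [c ->]; rewrite big_seq; elim/big_ind: _ => [||a aB].
- exact: NN0.
- exact: NND.
- by apply/NNMn/NN_gen/BA.
Qed.

Lemma NN_gens_of u x : NN (gens_of u) x -> NN A x.
Proof. by apply: NN_sub => a; rewrite gens_ofP => /andP[]. Qed.

Lemma Sc_add x y : Sc x -> NN A y -> Sc (x + y).
Proof. by move=> Sx Ay; apply: Sc_NN; exists x => //; exists y. Qed.

Lemma S_add x y : S x -> NN A y -> S (x + y).
Proof. by move=> Sx Ay; apply: S_NN; exists x => //; exists y. Qed.

Lemma Sc_lower u : normal u -> exists N : nat, forall x, Sc x -> - N%:Z <= lform u x.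
Proof.
move=> nu; have [G ScE] := Sc_fg.
have [|N NP] := @uniform_bound _ (enum_fset G) (fun g N => - N%:Z <= lform u g).
  by move=> g _; exists `|lform u g|%N => n; lia.
exists N => x; rewrite ScE => -[g Gg [y Ay <-]]; rewrite lformD.
have := NP g Gg N (leqnn N); have := NN_lform_ge0 A_gen nu Ay; lia.
Qed.

(** The values of the normal on NA form a numerical semigroup: since the normal
    is primitive and A generates the lattice, it contains two consecutive
    integers k and k + 1, hence every integer from k^2 on. *)
Lemma Sc_upper u : normal u -> Sc !=set0 ->
  exists N : nat, forall n, N%:Z <= n -> exists2 x, Sc x & lform u x = n.
Proof.
move=> nu [x0 Sx0]; have [_ _ _ [e ue] _] := normal_spec A_gen nu.
have [c eE] : ZZ A e by rewrite A_gen.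
pose p := \sum_(a <- A) a *+ (if 0 <= c a then `|c a|%N else 0%N).
pose q := \sum_(a <- A) a *+ (if 0 <= c a then 0%N else `|c a|%N).
have Ap : NN A p by exists (fun a => if 0 <= c a then `|c a|%N else 0%N).
have Aq : NN A q by exists (fun a => if 0 <= c a then 0%N else `|c a|%N).
have epq : e = p - q.
  rewrite eE /p /q -sumrB; apply: eq_bigr => a _.
  case: ifPn => ca; first by rewrite mulr0n subr0 pmulrn gez0_abs.
  by rewrite mulr0n sub0r pmulrn ltz0_abs ?mulrNz ?opprK // ltNge.
have [k qk] : exists k : nat, lform u q = k%:Z.
  by exists `|lform u q|%N; rewrite gez0_abs // (NN_lform_ge0 A_gen nu Aq).
have pk : lform u p = k.+1%:Z by move: ue; rewrite epq lformB qk; lia.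
exists (`|lform u x0| + k * k)%N => n nN.
pose j := `|n - lform u x0|%N.
have jE : n = lform u x0 + j%:Z by rewrite /j; lia.
have kj : (k * k <= j)%N by rewrite /j; lia.
exists (x0 + (p *+ (j %% k) + q *+ (j %/ k - j %% k))).
  by apply: Sc_add => //; apply: NND; apply: NNMn.
rewrite !lformD !lformMn pk qk jE; congr (_ + _).
rewrite -[X in X + _]mulr_natr -[X in _ + X]mulr_natr !natz -!PoszM -PoszD.
congr Posz.
have [->|k0] := posnP k.
  by rewrite modn0 mul0n addn0 mul1n.
have le : (j %% k <= j %/ k)%N.
  apply: leq_trans (ltnW (ltn_pmod j k0)) _.
  by rewrite leq_divRL.
rewrite [RHS](divn_eq j k); nia.
Qed.

(** The levels that the holes along the facet itself meet. A level in
    F_sigma(Sc) that is not of this kind contains elements of S in every coset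
    of Z(A cap sigma). *)
Definition hole_level u : set int :=
  [set n | exists2 j, tau j = face_of u & n = lform u (b j)].

Definition level u : set int :=
  [set n | (exists2 x, Sc x & lform u x = n) /\ ~ hole_level u n].

Lemma hole_level_bound u : exists N, forall n, hole_level u n -> (`|n| <= N)%N.
Proof.
exists (\max_j `|lform u (b j)|)%N => _ [j _ ->].
exact: (leq_bigmax (F := fun j => `|lform u (b j)|%N)).
Qed.

Lemma level_range u : normal u -> exists C : nat, (forall n, level u n -> - C%:Z <= n) /\
  (Sc !=set0 -> forall n, C%:Z <= n -> level u n).
Proof.
move=> nu; have [N1 N1P] := Sc_lower nu; have [N2 N2P] := hole_level_bound u.
have [N3 N3P] : exists N : nat, Sc !=set0 -> forall n, N%:Z <= n ->
    exists2 x, Sc x & lform u x = n.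
  have [Sc0|nSc0] := pselect (Sc !=set0); last by exists 0%N.
  by have [N] := Sc_upper nu Sc0; exists N.
exists (N1 + N2.+1 + N3)%N; split=> [n [[x Sx <-] _]|Sc0 n nN].
  by have := N1P x Sx; lia.
split; first by apply: N3P => //; lia.
by move=> /N2P; lia.
Qed.

Lemma level_up u : normal u -> exists C : nat, forall n, C%:Z <= n ->
  forall k, level u k -> level u (k + n).
Proof.
move=> nu; have [C [C1 C2]] := level_range nu.
exists (C + C)%N => n nC k Mk; apply: C2; last by have := C1 k Mk; lia.
by have [[x Sx _] _] := Mk; exists x.
Qed.

Lemma level_finite u n : normal u -> finite_set [set k | level u k /\ ~ level u (k + n)].
Proof.
move=> nu; have [C [C1 C2]] := level_range nu.
apply: (@finite_int_segment _ (C + `|n|)%N) => k [Mk nMk].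
have kC := C1 k Mk; have kn : ~ (C%:Z <= k + n).
  by move=> /C2 Mkn; apply: nMk; apply: Mkn; have [[x Sx _] _] := Mk; exists x.
by lia.
Qed.

Lemma hole_level_finite u : finite_set (hole_level u).
Proof.
by have [N NP] := hole_level_bound u; apply: finite_int_segment NP.
Qed.

(** One exponent serves all holes. *)
Lemma face_order : exists k, forall i y,
  emb R y \in fspan R (face_gens A (tau i)) -> ZZ (face_gens A (tau i)) (y *+ k.+1).
Proof.
have [k kP] := choice (fun i => span_torsion R (face_gens A (tau i))).
exists (\prod_i (k i).+1).-1 => i y yi.
rewrite prednK; last by rewrite prodn_gt0.
by rewrite (bigD1 i) //= mulrnA; apply: ZZMn; exact: kP.
Qed.

(** A face that lies in no facet is the whole cone, and its hole is the whole
    lattice. *)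
Lemma contains_face_some i : S !=set0 -> exists2 u, normal u & contains_face u (tau i).
Proof.
move=> [x /SP[_ /(_ i) nx]]; apply: contrapT => no; apply: nx.
apply/holeP; rewrite (face_in_no_facet A_gen (tau_face i)) ?A_gen //.
by move=> u nu cont; apply: no; exists u.
Qed.

(** Along every facet through a hole there is a hole of facet type at the same
    level: the mechanism behind both sufficient conditions. *)
Hypothesis hole_levels : forall i u, normal u -> contains_face u (tau i) ->
  hole_level u (lform u (b i)).

(** Suppose that no facet explains the exit. Then x + C y is still in Sc, so it
    is in some hole i. By hole_levels the normals u of the facets containing
    tau_i take hole levels at x + C y, hence at x, hence vanish at y. So y is in
    the span of tau_i, C y is in Z(A cap tau_i), and x is in hole i. *)
Lemma S_exit_level : exists C : nat, forall x y, S x -> ~ S (x + y *+ C.+1) ->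
  exists2 u, normal u &
    (level u (lform u x) /\ ~ level u (lform u (x + y *+ C.+1))) \/
    (hole_level u (lform u x) /\ lform u (y *+ C.+1) != 0).
Proof.
have [C CP] := face_order; exists C => x y /SP[Sx nx] nS.
apply: contrapT => no.
have Mxy u : normal u -> level u (lform u x) -> level u (lform u (x + y *+ C.+1)).
  by move=> nu Mx; apply: contrapT => nM; apply: no; exists u => //; left.
have Hxy u : normal u -> hole_level u (lform u x) -> lform u (y *+ C.+1) = 0.
  move=> nu Hx; apply/eqP; apply: contraT => yC; case: no.
  by exists u => //; right.
have Sxy : Sc (x + y *+ C.+1).
  apply: scoredP => u nu; have [Hx|nHx] := pselect (hole_level u (lform u x)).
    by exists x => //; rewrite lformD Hxy // addr0.
  have [|//] := Mxy u nu; by split=> //; exists x.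
apply: nS; apply/SP; split=> // i hi; case: (nx i); apply/holeP.
have -> : x - b i = x + y *+ C.+1 - b i - y *+ C.+1 by rewrite addrAC addrK.
apply: ZZB; first exact/holeP.
apply: CP; apply: (face_kernel A_gen (tau_face i)) => u nu cont.
have Hxyb : hole_level u (lform u (x + y *+ C.+1)).
  by rewrite (lform_hole cont hi); apply: hole_levels.
have [Hx|nHx] := pselect (hole_level u (lform u x)).
  have /eqP := Hxy u nu Hx.
  by rewrite lformMn mulrn_eq0 => /eqP.
have [|_ []//] := Mxy u nu; by split=> //; exists x.
Qed.

(** If the new level is outside F_sigma(Sc), translates along the facet of any
    point of S at level n are exits. Otherwise it is the level of some hole b_j
    along the facet. The point b_j - a, moved far inside the facet, is in Sc,
    and it has a level outside the hole levels for every facet, so hole_levels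
    keeps it out of the holes: it is in S, and a moves it into hole j. *)
Lemma S_dense_level u n a : normal u -> level u n -> ~ level u (n + lform u a) ->
  exists x (B : {fset 'rV[int]_d}), [/\ lform u x = n,
    forall y, NN B y -> S (x + y) /\ ~ S (x + y + a)
  & forall y, lform u y = 0 -> exists2 k, (0 < k)%N & ZZ B (y *+ k)].
Proof.
move=> nu [[x0 Sx0 x0n] nHn] nM.
suff [x xn Sx] : exists2 x, lform u x = n &
    forall y, NN (gens_of u) y -> S (x + y) /\ ~ S (x + y + a).
  by exists x, (gens_of u); split=> // y uy; apply: gens_of_dense.
have uB y : NN (gens_of u) y -> lform u y = 0.
  by move=> /NN_ZZ; apply: lform_ZZ => c; exact: gens_of0.
have [[j jF njE]|nH] := pselect (hole_level u (n + lform u a)); last first.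
  have [x Sx xn] := S_level nu Sx0; exists x; first by rewrite xn.
  move=> y By; split; first by apply: S_add => //; exact: NN_gens_of By.
  move=> /SP[Sxya _]; apply: nM; split=> //; exists (x + y + a) => //.
  by rewrite !lformD (uB y By) xn x0n addr0.
(* far inside the facet the other normals are beyond all their hole levels *)
have [U _ UP] := normals_finite R A_gen.
have [N NP] : exists N, forall v, v \in U -> forall k, (N <= k)%N -> v != u ->
    level v (lform v (b j - a + barycenter u *+ k)).
  apply: uniform_bound => v /UP nv; have [C [_ CP]] := level_range nv.
  exists (C + `|lform v (b j - a)|)%N => k Ck vu; apply: CP; first by exists x0.
  rewrite lformD lformMn -mulr_natr natz.
  have := lform_barycenter_gt0 A_gen nu nv; rewrite eq_sym vu => /(_ isT).
  set w := lform v (barycenter u) => w_gt0.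
  have : k%:Z <= w * k%:Z by rewrite ler_peMl //; lia.
  by lia.
pose x := b j - a + barycenter u *+ N.
have xn : lform u x = n.
  rewrite lformD lformMn lform_barycenter mul0rn addr0 lformB -njE.
  by rewrite addrK.
have level_x v : normal v -> level v (lform v x).
  move=> nv; have [->|vu] := eqVneq v u; last by apply: NP => //; apply/UP.
  by rewrite xn; split=> //; exists x0.
have S0 : S !=set0 by have [z Sz _] := S_level nu Sx0; exists z.
have Sx : S x.
  apply/SP; split.
    by apply: scoredP => v /level_x[].
  move=> i hi; have [v nv cont] := contains_face_some i S0.
  case: (level_x v nv) => _; apply; rewrite (lform_hole cont hi).
  exact: hole_levels.
exists x => // y By; split; first by apply: S_add => //; exact: NN_gens_of By.
move=> /SP[_ /(_ j)]; apply; apply/holeP; rewrite jF face_gens_of.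
have -> : x + y + a - b j = barycenter u *+ N + y.
  rewrite /x; move: (barycenter u *+ N) (b j) => w bj.
  by apply/rowP => k; rewrite !mxE; ring.
by apply: ZZD; apply: NN_ZZ => //; apply: NNMn; exact: NN_barycenter.
Qed.

Theorem hole_levels_noetherian (K : closedFieldType) :
  [pchar K] =i pred0 -> left_noetherian (Dring K S).
Proof.
move=> K0; have [U U_uniq UP] := normals_finite R A_gen.
apply: (@level_set_noetherian K d K0 U level hole_level S) => //.
- by move=> u /UP /(normal_spec A_gen)[].
- move=> u v /UP nu /UP nv uv; exists (barycenter v).
    exact: lform_barycenter.
  by rewrite gt_eqF // lform_barycenter_gt0 // eq_sym.
- have [|C CP] := @uniform_bound _ U (fun u C => forall n, C%:Z <= n ->
      forall k, level u k -> level u (k + n)).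
    move=> u /UP/level_up[C CP]; exists C => n Cn k kn; apply: CP; lia.
  by exists C => u uU; apply: CP uU _ (leqnn C).
- by move=> u /UP nu n; apply: level_finite.
- by move=> u _; apply: hole_level_finite.
- by move=> u n a /UP; apply: S_dense_level.
- have [C CP] := S_exit_level; exists C => x y Sx nS.
  by have [u /UP uU uP] := CP x y Sx nS; exists u.
Qed.

End Levels.

(** * The two sufficient conditions *)

(** An integral form extends to K^d, and the integers embed in K. *)
Lemma lform_fspan (K : fieldType) (d : nat) (B : {fset 'rV[int]_d})
    (u : 'cV[int]_d) (c : 'rV[int]_d) : [pchar K] =i pred0 ->
  (forall a, a \in B -> lform u a = 0) -> emb K c \in fspan K B -> lform u c = 0.
Proof.
move=> K0 uB; have mapE a : (emb K a *m map_mx intr u) 0 0 = (lform u a)%:~R.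
  by rewrite /emb -map_mxM mxE.
rewrite fspanP => /submxP[D cE].
apply: (intr_inj_pchar0 K0); rewrite -mapE cE -mulmxA.
have /eqP -> : gen_mx K B *m map_mx intr u == 0.
  apply/gen_mx_mul0 => a aB; apply/rowP => i.
  by rewrite ord1 mapE uB // mxE.
by rewrite mulmx0 mxE.
Qed.

Section Conditions.
Variables (R : realType) (d : nat) (A : {fset 'rV[int]_d}).
Variables (Sc S : set 'rV[int]_d) (m : nat).
Variables (b : 'I_m -> 'rV[int]_d) (tau : 'I_m -> set 'rV[R]_d).
Hypotheses (A_gen : ZZ A = setT)
  (tau_face : forall i, is_face (cone A) (tau i)).
Local Notation normal := (@normal R d A).

(** In b_i + b_tau_i = b_j + b_tau_j modulo Z(A cap sigma), everything but b_i
    and b_j is killed by the normal of sigma. *)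
Lemma calB_hole_level (K : fieldType) : [pchar K] =i pred0 ->
  calB b tau K A !=set0 -> forall i u, normal u -> contains_face A u (tau i) ->
  hole_level A b tau u (lform u (b i)).
Proof.
move=> K0 [beta [beta_coset beta_compat]] i u nu cont.
have [uF _ _ _ _] := normal_spec A_gen nu.
have uT : Ftilde tau A (face_of A u) by left.
have tau_uF : is_face (face_of A u) (tau i).
  have [F F_ge0 tE] := tau_face i; exists F; first by move=> x [/F_ge0].
  apply/seteqP; split=> x; last by move=> [[Ax _] Fx]; rewrite tE.
  move=> tx; split; first exact: contains_face_sub (tau_face i) cont x tx.
  by move: tx; rewrite tE => -[].
have [j jF jE] := beta_compat i _ uT tau_uF.
exists j => //.
have [|c cK cE] := beta_coset (tau i); first by right; exists i.
have [c' c'K c'E] := beta_coset _ uT.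
have c0 : lform u c = 0 by apply: (lform_fspan K0) cK; exact: cont.
have gens0 a : a \in face_gens A (face_of A u : set 'rV[R]_d) -> lform u a = 0.
  by rewrite face_gens_of; exact: gens_of0.
have c'0 : lform u c' = 0 by apply: (lform_fspan K0) c'K.
have := congr1 (fun X => X (b i + (c + 0) + 0)) jE; rewrite jF c'E cE => bi.
have : setadd (setadd [set b j]
      (setadd [set c'] (ZZ (face_gens A (face_of A u : set 'rV[R]_d)))))
    (ZZ (face_gens A (face_of A u : set 'rV[R]_d))) (b i + (c + 0) + 0).
  rewrite -bi; exists (b i + (c + 0)); last by exists 0 => //; exact: ZZ0.
  exists (b i) => //; exists (c + 0) => //.
  by exists c => //; exists 0 => //; exact: ZZ0.
move=> [_ [_ -> [_ [_ -> [z Zz <-]] <-]] [z' Zz' /(congr1 (lform u))]].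
rewrite !lformD lform0 c0 c'0 (lform_ZZ gens0 Zz) (lform_ZZ gens0 Zz').
by rewrite !addr0 => ->.
Qed.

Hypotheses (Sc_NN : is_NNset A Sc)
  (SE : S = Sc `\` \bigcup_i hole b tau A i)
  (S_irredundant :
    forall k, S <> Sc `\` \bigcup_(i in [set i | i != k]) hole b tau A i)
  (S_levels : forall sigma : set 'rV[R]_d, facets A sigma ->
     Fsigma A sigma @` S = Fsigma A sigma @` Sc).

(** By irredundancy some x in Sc lies in hole i only, and by (S_2) it is outside
    S + Z(A cap sigma) for some facet sigma. Far from x inside sigma, the only
    holes met are those along sigma itself, so x lies in one of these. *)
Lemma serre_hole_facet i : serre_S2 R A S ->
  exists2 u, normal u & tau i = face_of A u.
Proof.
move=> S_S2.
have [x [Sx hx]] : exists x, [/\ Sc x, ~ S x & forall j, hole b tau A j x -> j = i].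
  apply: contrapT => nox; apply: (S_irredundant (k := i)); apply/seteqP; split.
    rewrite {1}SE => x [Sx nx]; split=> // -[j _ hj]; apply: nx; by exists j.
  move=> x [Sx nx]; apply: contrapT => nSx; apply: nox; exists x; split=> // j hj.
  by apply/eqP; apply: contrapT => /negP ji; apply: nx; exists j.
move=> only_i.
have [u nu nSx] : exists2 u, normal u & ~ setadd S (ZZ (gens_of R A u)) x.
  apply: contrapT => no; apply: hx; rewrite S_S2 => sigma.
  move=> /(facet_normal A_gen)[u nu ->]; rewrite face_gens_of.
  by apply: contrapT => nSx; apply: no; exists u.
exists u => //.
suff [j jF hj] : exists2 j, tau j = face_of A u & hole b tau A j x.
  by rewrite -(only_i j hj).
have [U _ UP] := normals_finite R A_gen.
pose w := barycenter R A u.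
have [N NP] : exists N, forall v, v \in U -> forall k, (N <= k)%N -> v != u ->
    forall j, lform v (x + w *+ k) != lform v (b j).
  apply: uniform_bound => v /UP nv.
  exists (`|lform v x| + (\max_j `|lform v (b j)|).+1)%N => k Nk vu j.
  have bj : (`|lform v (b j)| <= \max_j `|lform v (b j)|)%N.
    exact: (leq_bigmax (F := fun j => `|lform v (b j)|%N)).
  rewrite lformD lformMn -mulr_natr natz.
  have := lform_barycenter_gt0 A_gen nu nv; rewrite eq_sym vu => /(_ isT).
  rewrite -/w; set y := lform v w => y_gt0.
  have : k%:Z <= y * k%:Z by rewrite ler_peMl //; lia.
  move: bj Nk; set B := (\max_j _)%N; lia.
have ScN : Sc (x + w *+ N).
  apply: Sc_NN; exists x => //; exists (w *+ N) => //.
  apply: NNMn; apply: NN_gens_of; exact: NN_barycenter.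
have S0 : S !=set0 by have [z Sz _] := S_level A_gen S_levels nu Sx; exists z.
have Zw : ZZ (gens_of R A u) (w *+ N) by apply/ZZMn/NN_ZZ/NN_barycenter.
have [Sxw|nSxw] := pselect (S (x + w *+ N)).
  by case: nSx; exists (x + w *+ N) => //; exists (- (w *+ N)); [exact: ZZN|rewrite addrK].
have [j hj] : exists j, hole b tau A j (x + w *+ N).
  apply: contrapT => noj; apply: nSxw; apply/(SP SE); split=> // j hj.
  by apply: noj; exists j.
have only v : normal v -> contains_face A v (tau j) -> v = u.
  move=> nv cont; apply/eqP; apply: contraT => vu.
  have /UP vU := nv.
  by have := NP v vU N (leqnn N) vu j; rewrite (lform_hole cont hj) eqxx.
have [v nv cont] := contains_face_some A_gen tau_face SE j S0.
have jF : tau j = face_of A u.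
  apply: (face_of_single_facet A_gen nu (tau_face j)) => //.
  by rewrite -(only v nv cont).
exists j => //; apply/holeP.
have -> : x - b j = x + w *+ N - b j - w *+ N by rewrite addrAC addrK.
by apply: ZZB; [exact/holeP|rewrite jF face_gens_of].
Qed.

Lemma serre_hole_level : serre_S2 R A S ->
  forall i u, normal u -> contains_face A u (tau i) ->
  hole_level A b tau u (lform u (b i)).
Proof.
move=> S_S2 i u nu cont; have [v nv tE] := serre_hole_facet i S_S2.
exists i => //; rewrite tE; congr face_of; apply: (normal_inj A_gen nv nu) => a av.
by apply: cont; rewrite tE face_gens_of.
Qed.

End Conditions.

Theorem theorem6p12 (K : closedFieldType) (R : realType) (d : nat)
    (A : {fset 'rV[int]_d}) (Sc S : set 'rV[int]_d) (m : nat)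
    (b : 'I_m -> 'rV[int]_d) (tau : 'I_m -> set 'rV[R]_d) :
  [pchar K] =i pred0 ->
  ZZ A = setT ->
  strongly_convex (cone (R := R) A) ->
  is_NNset A Sc -> fin_gen A Sc -> scored R A Sc ->
  (forall i, Sc (b i)) ->
  (forall i, is_face (cone A) (tau i)) ->
  S = Sc `\` \bigcup_i hole b tau A i ->
  (forall k, S <> Sc `\` \bigcup_(i in [set i | i != k]) hole b tau A i) ->
  (forall sigma : set 'rV[R]_d, facets A sigma ->
     Fsigma A sigma @` S = Fsigma A sigma @` Sc) ->
  is_NNset A S ->
  (calB b tau K A !=set0 -> left_noetherian (Dring K S)) /\
  (serre_S2 R A S -> left_noetherian (Dring K S)).
Proof.
move=> K0 A_gen _ Sc_NN Sc_fg Sc_scored Sc_b tau_face SE S_irr S_levels S_NN.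
have noeth : (forall i u, normal R A u -> contains_face A u (tau i) ->
    hole_level A b tau u (lform u (b i))) -> left_noetherian (Dring K S).
  move=> hole_levels; exact: (hole_levels_noetherian (R := R) A_gen Sc_NN Sc_fg
    Sc_scored tau_face SE S_levels S_NN hole_levels K0).
split=> [B0|S_S2]; apply: noeth; first exact: (calB_hole_level A_gen tau_face K0 B0).
exact: (serre_hole_level A_gen tau_face Sc_NN SE S_irr S_levels S_S2).
Qed.
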